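(* Let $(M,g)$ be an FLRW spacetime with spatial curvature $\kappa\in\mathbb{R}$ and scale factor $a$, such that $a(t_0)=0$ for a certain $t_0$ and $a$ is smooth (and positive) for $t>t_0$. Let $\gamma(\tau(t))$ be a non-spacelike (timelike or null) geodesic in this spacetime which is non-comoving, i.e. its constant $C$ satisfies $C>0$. Define, for $t>t_0$, $$f(t)=3\ddot a+\frac{2C}{a}\left[\frac{\ddot a}{a}-\frac{\dot a^{2}}{a^{2}}-\frac{\kappa}{a^{2}}\right],$$ and let $f_+(t)=f(t)$ where $f(t)\ge 0$ and $f_+(t)=0$ where $f(t)<0$. Suppose that for some $t_1>t_0$ the following two conditions are satisfied: $$\lim_{t\to t_0}\int_{t}^{t_1}a(t')\int_{t'}^{t_1}\frac{1}{a(t'')}\left[\frac{\ddot a(t'')}{a(t'')}-\frac{\dot a(t'')^{2}}{a(t'')^{2}}-\frac{\kappa}{a(t'')^{2}}\right]dt''\,dt'=-\infty ,$$ $$\lim_{t\to t_0}\int_{t}^{t_1}f_+(t')\,dt'=\alpha\quad\text{for some }\alpha\in\mathbb{R}_{\ge 0}.$$ Then every point $\gamma(\tau(t_2))$ with $t_2\neq t_0$ (i.e. $t_2>t_0$) on the geodesic is conjugate, in the generalized sense defined in the context, to a point $\gamma(\tau(t'))$ with $t_0\le t'<t_2$.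
   Context: FLRW spacetime: the metric is, in spherical coordinates, $$ds^2=-dt^2+a(t)^2\left[\frac{dr^2}{1-\kappa r^2}+r^2\left(d\theta^2+\sin^2\theta\,d\varphi^2\right)\right],$$ i.e. $-dt^2+a(t)^2h$ with $h$ a Riemannian metric of constant curvature $\kappa$ on a three-dimensional space. Dots on $a$ denote $d/dt$. The scale factor is positive for $t>t_0$ and continuous up to $t_0$, where it vanishes; $t=t_0$ is the singularity, where the metric degenerates. The scale factor is normalized to equal $1$ at some time. Geodesics: a geodesic $\gamma(\tau)$, with $\tau$ an affine parameter (proper time in the timelike case), satisfies $$\frac{dt}{d\tau}=\frac{\sqrt{C-\epsilon_{\mathrm n}a^2}}{a},$$ with $\epsilon_{\mathrm n}=g(\dot\gamma,\dot\gamma)$ equal to $0$ for null geodesics and $-1$ for timelike geodesics. Here $C\ge 0$ is the constant equal to $a^2 g_{ij}\dot\gamma^i\dot\gamma^j$ (spatial indices $i,j$), i.e. to the squared length of the spatial velocity at the time where $a=1$. For $C>0$ the geodesic can be parametrized by $t$; it is taken to be defined for all $t$ from the singularity $t_0$ (excluded) up to and including the times considered. Curvature convention: $R(X,Y)Z=\nabla_X\nabla_YZ-\nabla_Y\nabla_XZ-\nabla_{[X,Y]}Z$. A Jacobi field along $\gamma$ is a vector field $J$ with $D_\tau^2J+R(J,\dot\gamma)\dot\gamma=0$, where $D_\tau$ is covariant differentiation along $\gamma$. Jacobi tensor based at $\gamma(\tau_2)$, where $\tau_2=\tau(t_2)$: - Timelike case: let $\{E_0=\dot\gamma,E_1,E_2,E_3\}$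 be a parallel orthonormal frame along $\gamma$, and let $J_i$ ($i=1,2,3$) be the Jacobi field with $J_i(\tau_2)=0$ and $D_\tau J_i(\tau_2)=E_i(\tau_2)$. Let $A(\tau)$ be the $3\times3$ matrix with entries $A^k{}_l=(J_l)^k$, the components in the frame $E_1,E_2,E_3$. Thus $A(\tau_2)=0$, $D_\tau A(\tau_2)=I$ and $D_\tau^2A+R(A\,\cdot,\dot\gamma)\dot\gamma=0$. - Null case: let $N(\gamma)$ be the bundle of vectors along $\gamma$ orthogonal to $\dot\gamma$ and let $\bar N(\gamma)=N(\gamma)/\langle\dot\gamma\rangle$ (rank 2), with the induced covariant derivative and the induced endomorphism $\bar R_\gamma(\bar v)=\overline{R(v,\dot\gamma)\dot\gamma}$. Let $\bar A(\tau)$ be the endomorphism field of $\bar N(\gamma)$ with $D_\tau^2\bar A+\bar R_\gamma\bar A=0$, $\bar A(\tau_2)=0$, $D_\tau\bar A(\tau_2)=I$; it is a $2\times2$ matrix in a parallel frame. Generalized conjugate points: for $t'>t_0$, $t'\ne t_2$, the point $\gamma(\tau(t'))$ is conjugate to $\gamma(\tau(t_2))$ if $\det A=0$ (respectively $\det\bar A=0$ in the null case) at $t'$. In the timelike case this is equivalent to the existence of a non-trivial Jacobi field along $\gamma$, orthogonal to $\dot\gamma$, vanishing at both points. For $t'=t_0$ (the singularity), $\gamma(\tau(t_2))$ is said to be conjugate to the point of $\gamma$ at $t_0$ if $\det A(\tau(t))\to0$ (respectively $\det\bar A(\tau(t))\to0$) as $t\to t_0^+$. *)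

(* Defs.v *)
From HB Require Import structures.
From mathcomp Require Import all_boot all_order all_algebra.
From mathcomp Require Import all_classical all_reals all_analysis.

Set Implicit Arguments.
Unset Strict Implicit.
Unset Printing Implicit Defensive.

Import Order.TTheory GRing.Theory Num.Theory.
Import numFieldNormedType.Exports.

Local Open Scope classical_set_scope.
Local Open Scope ring_scope.

(* Tangent vectors are written as row vectors of components, so that the
   differential of a change of coordinates F acts by v |-> v *m jacobian F x. *)

Definition partial (R : realType) n (i : 'I_n) (f : 'rV[R]_n -> R)
  : 'rV[R]_n -> R := fun x => 'D_(delta_mx 0 i) f x.

(* C^infinity on the open set U: all iterated partial derivatives of all
   components are (Frechet) differentiable on U. *)
Definition smooth_on (R : realType) m n (U : set 'rV[R]_m)
    (f : 'rV[R]_m -> 'rV[R]_n) : Prop :=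
  forall (j : 'I_n) (s : seq 'I_m) (x : 'rV[R]_m), U x ->
    differentiable (foldr (@partial R m) (fun y => f y 0 j) s) x.

Definition metric_at (R : realType) n (G : 'M[R]_n) (u v : 'rV[R]_n) : R :=
  (u *m G *m v^T) 0 0.

(* christoffel g k i j x is Gamma^k_{ij}(x). *)
Definition christoffel (R : realType) n (g : 'rV[R]_n -> 'M[R]_n)
    (k i j : 'I_n) (x : 'rV[R]_n) : R :=
  2^-1 * \sum_(l < n) invmx (g x) k l *
    (partial i (fun y => g y j l) x + partial j (fun y => g y i l) x
     - partial l (fun y => g y i j) x).

(* riemann g l k i j x is the d_l-component of R(d_i, d_j) d_k, where
   R(X,Y)Z = nabla_X nabla_Y Z - nabla_Y nabla_X Z - nabla_[X,Y] Z. *)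
Definition riemann (R : realType) n (g : 'rV[R]_n -> 'M[R]_n)
    (l k i j : 'I_n) (x : 'rV[R]_n) : R :=
  partial i (christoffel g l j k) x - partial j (christoffel g l i k) x
  + \sum_(m < n) (christoffel g l i m x * christoffel g m j k x
                  - christoffel g l j m x * christoffel g m i k x).

(* The vector R(X,Y)Z at x. *)
Definition curvature (R : realType) n (g : 'rV[R]_n -> 'M[R]_n)
    (x X Y Z : 'rV[R]_n) : 'rV[R]_n :=
  \row_l \sum_(i < n) \sum_(j < n) \sum_(k < n)
    riemann g l k i j x * X 0 i * Y 0 j * Z 0 k.

(* dr^2/(1 - kappa r^2) + r^2 (dtheta^2 + sin^2 theta dphi^2) at the
   coordinates y = (r, theta, phi). *)
Definition spherical_metric (R : realType) (kappa : R) (y : 'rV[R]_3)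
  : 'M[R]_3 :=
  diag_mx (\row_(i < 3) [:: (1 - kappa * y 0 0 ^+ 2)^-1;
                            y 0 0 ^+ 2;
                            y 0 0 ^+ 2 * sin (y 0 1) ^+ 2]`_i).

(* -dt^2 + a(t)^2 h at the coordinates x = (t, r, theta, phi). *)
Definition flrw_metric (R : realType) (kappa : R) (a : R -> R)
    (x : 'rV[R]_(1 + 3)) : 'M[R]_(1 + 3) :=
  block_mx (- 1)%:M 0
           0 (a (x 0 0) ^+ 2 *: spherical_metric kappa (rsubmx x)).

(* A three-dimensional Riemannian manifold of constant curvature kappa,
   presented by an atlas of spherical charts. A single such chart misses its
   origin and axis (and, for kappa > 0, its equator and beyond), but these
   points lie in other charts of the atlas, centred elsewhere. *)
Record space_form (R : realType) (kappa : R) := SpaceForm {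
  space :> topologicalType;
  chart : Type;
  chart_dom : chart -> set space;
  coord : chart -> space -> 'rV[R]_3;
  coord_inv : chart -> 'rV[R]_3 -> space;
  space_hausdorff : hausdorff_space space;
  space_second_countable : @second_countable space;
  chart_cover : forall p, exists c, chart_dom c p;
  chart_dom_open : forall c, open (chart_dom c);
  chart_image_open : forall c, open (coord c @` chart_dom c);
  coordK : forall c p, chart_dom c p -> coord_inv c (coord c p) = p;
  coord_continuous : forall c p, chart_dom c p ->
    {for p, continuous (coord c)};
  coord_inv_continuous : forall c p, chart_dom c p ->
    {for coord c p, continuous (coord_inv c)};
  chart_spherical : forall c p, chart_dom c p ->
    [/\ 0 < coord c p 0 0, kappa * coord c p 0 0 ^+ 2 < 1
      & 0 < coord c p 0 1 < pi];
  transition_smooth : forall c d,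
    smooth_on (coord c @` (chart_dom c `&` chart_dom d))
              (coord d \o coord_inv c);
  transition_isometry : forall c d p, chart_dom c p -> chart_dom d p ->
    let J := jacobian (coord d \o coord_inv c) (coord c p) in
    spherical_metric kappa (coord c p)
      = J *m spherical_metric kappa (coord d p) *m J^T
}.

(* The scale factor is only meaningful on [t0, +oo[. *)
Definition scale_factor (R : realType) (t0 : R) (a : R -> R) : Prop :=
  [/\ a t0 = 0, a x @[x --> t0^'+] --> a t0,
      forall t, t0 < t -> 0 < a t,
      forall (n : nat) t, t0 < t -> derivable (derive1n n a) t 1
    & exists2 t, t0 < t & a t = 1].

(* A curve tau |-> (ctime tau, cspace tau) in the spacetime
   ]t0, +oo[ x M, for tau in cdom. *)
Record curve (R : realType) (S : Type) := Curve {
  cdom : set R;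
  ctime : R -> R;
  cspace : R -> S
}.

Section along_curve.
Context {R : realType} {kappa : R} (a : R -> R) {M : space_form kappa}.
Context (gam : curve R M).

Local Notation g := (flrw_metric kappa a).

Definition cpos (c : chart M) (s : R) : 'rV[R]_(1 + 3) :=
  row_mx (ctime gam s)%:M (coord c (cspace gam s)).

(* A vector field along the curve is given by its components in each chart;
   V c s is meaningful when s is in the domain of the curve and the chart c
   covers the curve at s. *)
Definition field := chart M -> R -> 'rV[R]_(1 + 3).

Definition on_chart (c : chart M) (s : R) : Prop :=
  cdom gam s /\ chart_dom c (cspace gam s).

Definition is_field (V : field) : Prop :=
  forall c d s, on_chart c s -> on_chart d s ->
    V d s = V c s *m block_mx 1%:M 0 0
      (jacobian (coord d \o coord_inv c) (coord c (cspace gam s))).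

Definition derivable_field (V : field) : Prop :=
  forall c s (mu : 'I_(1 + 3)), on_chart c s ->
    derivable (fun u => V c u 0 mu) s 1.

Definition velocity : field :=
  fun c s => \row_mu derive1 (fun u => cpos c u 0 mu) s.

Definition covD (V : field) : field := fun c s =>
  \row_mu (derive1 (fun u => V c u 0 mu) s
    + \sum_(nu < 1 + 3) \sum_(la < 1 + 3)
        christoffel g mu nu la (cpos c s) * velocity c s 0 nu * V c s 0 la).

(* R(J, gamma') gamma' *)
Definition tidal (J : field) : field := fun c s =>
  curvature g (cpos c s) (J c s) (velocity c s) (velocity c s).

Definition gdot (V W : field) (c : chart M) (s : R) : R :=
  metric_at (g (cpos c s)) (V c s) (W c s).

(* Affinely parametrised future-directed geodesic with g(gamma',gamma') = eps
   and a^2 g_ij gamma'^i gamma'^j = C, defined on an open interval of the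
   affine parameter and for all times from the singularity t0 (excluded) on. *)
Definition is_geodesic (t0 eps C : R) : Prop :=
  [/\ open (cdom gam) /\ is_interval (cdom gam),
      forall s, cdom gam s -> t0 < ctime gam s,
      forall s, cdom gam s -> forall t, t0 < t <= ctime gam s ->
        (ctime gam @` cdom gam) t
    & forall s, cdom gam s -> {for s, continuous (cspace gam)}] /\
  [/\ forall c s (mu : 'I_(1 + 3)), on_chart c s ->
        derivable (fun u => cpos c u 0 mu) s 1,
      derivable_field velocity
    & forall c s, on_chart c s -> covD velocity c s = 0] /\
  [/\ forall s, cdom gam s -> 0 < derive1 (ctime gam) s,
      forall c s, on_chart c s -> gdot velocity velocity c s = eps
    & forall c s, on_chart c s ->
        a (ctime gam s) ^+ 2 *
          \sum_(i < 3) \sum_(j < 3)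
            g (cpos c s) (rshift 1 i) (rshift 1 j)
              * velocity c s 0 (rshift 1 i) * velocity c s 0 (rshift 1 j)
        = C].

Definition jacobi_field (J : field) : Prop :=
  [/\ is_field J, derivable_field J, derivable_field (covD J)
    & forall c s, on_chart c s -> covD (covD J) c s + tidal J c s = 0].

Definition parallel_orthonormal_frame (E : 'I_(1 + 3) -> field) : Prop :=
  [/\ forall i, is_field (E i) /\ derivable_field (E i),
      forall c s, on_chart c s -> E 0 c s = velocity c s,
      forall i c s, on_chart c s -> covD (E i) c s = 0
    & forall i j c s, on_chart c s ->
        gdot (E i) (E j) c s
        = if i == j then (if i == 0 then -1 else 1) else 0].

(* Equality modulo the span of gamma'. *)
Definition eq_mod_velocity (c : chart M) (s : R) (u v : 'rV[R]_(1 + 3))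
  : Prop :=
  exists b : R, u - v = b *: velocity c s.

(* A k l is the component along E_{k+1} of the Jacobi field J l; the
   component along E_0 = gamma' is discarded by eq_mod_velocity. *)
Definition timelike_jacobi_tensor (s2 : R) (A : R -> 'M[R]_3) : Prop :=
  exists (E : 'I_(1 + 3) -> field) (J : 'I_3 -> field),
  [/\ parallel_orthonormal_frame E,
      forall l, jacobi_field (J l),
      forall l c, on_chart c s2 ->
        J l c s2 = 0 /\ covD (J l) c s2 = E (rshift 1 l) c s2
    & forall l c s, on_chart c s ->
        eq_mod_velocity c s (J l c s)
          (\sum_(k < 3) A s k l *: E (rshift 1 k) c s)].

(* Representatives E 0, E 1 in N(gamma) of a parallel frame of
   N(gamma)/<gamma'>. *)
Definition null_parallel_frame (E : 'I_2 -> field) : Prop :=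
  [/\ forall i, is_field (E i) /\ derivable_field (E i),
      forall i c s, on_chart c s -> gdot (E i) velocity c s = 0,
      forall i c s, on_chart c s -> eq_mod_velocity c s (covD (E i) c s) 0
    & forall c s (x : 'I_2 -> R), on_chart c s ->
        eq_mod_velocity c s (\sum_(i < 2) x i *: E i c s) 0 ->
        forall i, x i = 0].

(* A is the matrix of the endomorphism field in the frame E; as E is parallel,
   covariant derivatives of the former are entrywise derivatives of A. The
   last clause is the Jacobi equation applied to the class of E l. *)
Definition null_jacobi_tensor (s2 : R) (A : R -> 'M[R]_2) : Prop :=
  exists E : 'I_2 -> field,
  [/\ null_parallel_frame E,
      forall s k l, cdom gam s ->
        derivable (fun u => A u k l) s 1 /\
        derivable (derive1 (fun u => A u k l)) s 1,
      A s2 = 0 /\ \matrix_(k, l) derive1 (fun u => A u k l) s2 = 1%:M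
    & forall l c s, on_chart c s ->
        eq_mod_velocity c s
          (\sum_(k < 2) derive1n 2 (fun u => A u k l) s *: E k c s
           + tidal (fun d u => \sum_(k < 2) A u k l *: E k d u) c s)
          0].

End along_curve.

(* The point at time t' is conjugate to the base point of the Jacobi tensor A;
   tau is the affine parameter as a function of time. *)
Definition conjugate_at (R : realType) n (A : R -> 'M[R]_n) (tau : R -> R)
    (t0 t' : R) : Prop :=
  (t0 < t' /\ \det (A (tau t')) = 0) \/
  (t' = t0 /\ \det (A (tau t)) @[t --> t0^'+] --> (0 : R)).

(* a''/a - a'^2/a^2 - kappa/a^2 *)
Definition hubble_term (R : realType) (kappa : R) (a : R -> R) (t : R) : R :=
  derive1n 2 a t / a t - derive1 a t ^+ 2 / a t ^+ 2 - kappa / a t ^+ 2.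

Definition focusing (R : realType) (kappa C : R) (a : R -> R) (t : R) : R :=
  3 * derive1n 2 a t + 2 * C / a t * hubble_term kappa a t.

(* Main.v *)
(** In a parallel frame the Jacobi tensor decouples. Transverse to the plane of
    d/dt and gamma' its entries solve y'' = q y, which has the explicit solutions
    a sn_kappa(chi) and a cs_kappa(chi), where chi is the comoving distance to
    the base point; in that plane (timelike case) they solve y'' = (a''/a) y,
    which has the solution sqrt (C + a^2). Comparing Wronskians, the radial part
    stays bounded near t0 and the transverse part is a multiple of
    a sn_kappa(chi), so every point is conjugate to the singularity itself as
    soon as a sn_kappa(chi) -> 0. For kappa > 0 this holds because sn_kappa is
    bounded. For kappa <= 0 it is enough to treat the null case, where chi is the
    conformal time, and there the first integral condition, fed into the Riccati
    inequality for the logarithmic derivative, sends ln (a sn_kappa(chi)) to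
    minus infinity.

    The time component p of a parallel field orthogonal to gamma' satisfies
    a p = const, which makes the decoupling explicit without choosing an adapted
    frame. *)

Require Import Defs.
From mathcomp Require Import all_boot all_order all_algebra.
From mathcomp Require Import all_classical all_reals all_analysis.
From mathcomp Require Import ring lra.
Import Order.TTheory GRing.Theory Num.Theory.
Import numFieldNormedType.Exports.
Local Open Scope classical_set_scope.
Local Open Scope ring_scope.

(** * Calculus on the line *)

Section pointwise_derivatives.
Context {R : realType}.
Implicit Types (f g : R -> R) (x k : R).

Lemma is_derive1D f g x df dg : is_derive x 1 f df -> is_derive x 1 g dg ->
  is_derive x 1 (fun y => f y + g y) (df + dg).
Proof. by move=> hf hg; exact: is_deriveD. Qed.

Lemma is_derive1N f x df : is_derive x 1 f df ->
  is_derive x 1 (fun y => - f y) (- df).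
Proof. by move=> hf; exact: is_deriveN. Qed.

Lemma is_derive1B f g x df dg : is_derive x 1 f df -> is_derive x 1 g dg ->
  is_derive x 1 (fun y => f y - g y) (df - dg).
Proof. by move=> hf hg; exact: is_deriveB. Qed.

Lemma is_derive1M f g x df dg : is_derive x 1 f df -> is_derive x 1 g dg ->
  is_derive x 1 (fun y => f y * g y) (df * g x + f x * dg).
Proof.
move=> hf hg; have := is_deriveM hf hg.
by rewrite /GRing.scale /= addrC [g x * df]mulrC.
Qed.

Lemma is_derive1Z f k x df : is_derive x 1 f df ->
  is_derive x 1 (fun y => k * f y) (k * df).
Proof. by move=> hf; exact: (@is_deriveZ _ _ _ f k). Qed.

Lemma is_derive1V f x df : f x != 0 -> is_derive x 1 f df ->
  is_derive x 1 (fun y => (f y)^-1) (- df / f x ^+ 2).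
Proof.
move=> fx hf; have := is_deriveV fx hf.
by rewrite /GRing.scale /= mulrC mulrN mulNr.
Qed.

Lemma is_derive1_sqr f x df : is_derive x 1 f df ->
  is_derive x 1 (fun y => f y ^+ 2) (2 * f x * df).
Proof.
move=> hf; have := is_derive1M _ _ _ _ _ hf hf.
rewrite (_ : df * f x + f x * df = 2 * f x * df) //; by ring.
Qed.

Lemma is_derive1C k x : is_derive x 1 (fun=> k) (0 : R).
Proof. exact: is_derive_cst. Qed.

Lemma is_derive1_chain f g x df dg : is_derive (g x) 1 f df ->
  is_derive x 1 g dg -> is_derive x 1 (fun y => f (g y)) (df * dg).
Proof. by move=> hf hg; exact: is_derive1_comp. Qed.

Lemma is_derive1_sum n (h : 'I_n -> R -> R) x (dh : 'I_n -> R) :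
  (forall i, is_derive x 1 (h i) (dh i)) ->
  is_derive x 1 (fun y => \sum_(i < n) h i y) (\sum_(i < n) dh i).
Proof.
move=> H; have := is_derive_sum H.
rewrite (_ : \sum_(i < n) h i = (fun y => \sum_(i < n) h i y)) //.
by apply/funext => y; rewrite fct_sumE.
Qed.

Lemma is_derive1_derive1 f x df : is_derive x 1 f df -> derive1 f x = df.
Proof. by move=> [_ <-]; rewrite derive1E. Qed.

Lemma derivable_is_derive1 f x : derivable f x 1 ->
  is_derive x 1 f (derive1 f x).
Proof. by move=> /derivableP; rewrite derive1E. Qed.

Lemma is_derive1_derivable f x df : is_derive x 1 f df -> derivable f x 1.
Proof. by case. Qed.

Lemma is_derive1_continuous f x df : is_derive x 1 f df ->
  {for x, continuous f}.
Proof.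
by move=> [hf _]; apply: differentiable_continuous; apply/derivable1_diffP.
Qed.

End pointwise_derivatives.

(** * Monotonicity from bounds on the derivative *)

Section monotonicity.
Context {R : realType}.
Implicit Types (f g : R -> R) (D : set R).

Lemma derive_ge0_le f df (x y : R) : x <= y ->
  (forall z, x <= z <= y -> is_derive z 1 f (df z)) ->
  (forall z, x <= z <= y -> 0 <= df z) -> f x <= f y.
Proof.
move=> xy hf h0.
have [||c] := @MVT_segment R f df x y xy.
- by move=> z /[!in_itv]/= /andP[a b]; apply: hf; rewrite !ltW.
- apply: (@derivable_within_continuous R R f `[x, y]) => z.
  by rewrite in_itv => /hf [].
- by rewrite in_itv => /h0 c0 e; rewrite -subr_ge0 e mulr_ge0 // subr_ge0.
Qed.

Lemma is_interval_segment D (x y z : R) : is_interval D -> D x -> D y ->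
  x <= z <= y -> D z.
Proof. by move=> iD Dx Dy; apply: iD. Qed.

(** Both [g - f] and [g + f] have a non-negative derivative on [D], hence are nondecreasing between
    [x] and [y]. *)
Lemma derive_le_ge0_interval f g df dg D (x y : R) : is_interval D ->
  D x -> D y -> x <= y ->
  (forall z, D z -> is_derive z 1 f (df z)) ->
  (forall z, D z -> is_derive z 1 g (dg z)) ->
  (forall z, D z -> `|df z| <= dg z) -> `|f y - f x| <= g y - g x.
Proof.
move=> iD Dx Dy xy hf hg h.
have Dz z : x <= z <= y -> D z by exact: is_interval_segment.
have h1 : g x - f x <= g y - f y.
  apply: (@derive_ge0_le (fun z => g z - f z) (fun z => dg z - df z) x y xy).
    by move=> z /Dz Dz1; apply: is_derive1B; [exact: hg|exact: hf].
  by move=> z /Dz /h /ler_normlP [_ ?]; rewrite subr_ge0.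
have h2 : g x + f x <= g y + f y.
  apply: (@derive_ge0_le (fun z => g z + f z) (fun z => dg z + df z) x y xy).
    by move=> z /Dz Dz1; apply: is_derive1D; [exact: hg|exact: hf].
  by move=> z /Dz /h /ler_normlP [? _]; rewrite -(opprK (df z)) subr_ge0.
by rewrite ler_norml; apply/andP; split; lra.
Qed.

Lemma derive_eq0_interval f D (x y : R) : is_interval D -> D x -> D y ->
  (forall z, D z -> is_derive z 1 f 0) -> f x = f y.
Proof.
move=> iD.
wlog xy : x y / x <= y.
  move=> H Dx Dy hf; case: (leP x y) => [xy|/ltW xy]; first exact: H.
  by apply/esym/H.
move=> Dx Dy hf; apply/esym/eqP; rewrite -subr_eq0 -normr_le0.
have := @derive_le_ge0_interval f (fun=> 0) (fun=> 0) (fun=> 0) D x y iD Dx Dy xy hf.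
by rewrite subr0; apply => z _; rewrite normr0.
Qed.

End monotonicity.

(** * Antiderivatives of continuous functions on an open half-line *)

Section antiderivative.
Context {R : realType} (t0 : R) (f : R -> R).
Hypothesis cf : forall t, t0 < t -> {for t, continuous f}.
Notation mu := (@lebesgue_measure R).

Let cf_within (x y : R) : t0 < x -> {within `[x, y], continuous f}.
Proof.
move=> tx; apply: continuous_in_subspaceT => z.
by rewrite inE /= in_itv /= => /andP[xz _]; apply: cf; exact: lt_le_trans xz.
Qed.

Let intf (x y : R) : t0 < x -> mu.-integrable `[x, y] (EFin \o f).
Proof.
by move=> tx; apply: continuous_compact_integrable;
  [exact: segment_compact|exact: cf_within].
Qed.

Let intf_split (x y z : R) : t0 < x -> x <= y -> y <= z ->
  (\int[mu]_(t in `[x, z]) f t)%R =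
  (\int[mu]_(t in `[x, y]) f t + \int[mu]_(t in `[y, z]) f t)%R.
Proof.
move=> tx xy yz; have := @Rintegral_itvB R f (BLeft x) (BRight z) y (intf x z tx).
rewrite !bnd_simp => /(_ xy yz) /(canRL (subrK _)) ->.
rewrite addrC Rintegral_itv_obnd_cbnd //.
apply: integrableS (intf x z tx) => //.
by apply: subset_itvr; rewrite bnd_simp.
Qed.

Lemma antiderivative_exists :
  exists F : R -> R, forall t, t0 < t -> is_derive t 1 F (f t).
Proof.
(* The function built below is the signed integral from [c] to [x]. Its base point [b x] moves with
   [x] so as to stay after [t0] and before both [x] and [c]; subtracting the integral up to [c]
   makes the value independent of that base point. *)
pose b x := t0 + Num.min (x - t0) 1 / 2.
pose c := t0 + 1.
exists (fun x => (\int[mu]_(t in `[b x, x]) f t - \int[mu]_(t in `[b x, c]) f t)%R).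
move=> t tt.
(* For [x > (t0 + t) / 2] one has [b1 <= b x], so near [t] the fixed base point [b1] may replace
   [b x], and the fundamental theorem of calculus applies. *)
pose b1 := t0 + Num.min (t - t0) 1 / 4.
have m0 : 0 < Num.min (t - t0) 1 by rewrite lt_min subr_gt0 tt ltr01.
have mt : Num.min (t - t0) 1 <= t - t0 by rewrite ge_min lexx.
have m1 : Num.min (t - t0) 1 <= 1 by rewrite ge_min lexx orbT.
have tb1 : t0 < b1 by rewrite /b1; lra.
have b1t : b1 < t by rewrite /b1; lra.
apply: (@near_eq_is_derive _ _ _
  (fun x => (\int[mu]_(t in `[b1, x]) f t - \int[mu]_(t in `[b1, c]) f t)%R)).
  have : \forall x \near t, (t0 + t) / 2 < x by apply: lt_nbhsr; lra.
  apply: filterS => x hx.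
  have mx : Num.min (x - t0) 1 <= x - t0 by rewrite ge_min lexx.
  have mx1 : Num.min (x - t0) 1 <= 1 by rewrite ge_min lexx orbT.
  have mx2 : Num.min (t - t0) 1 / 2 <= Num.min (x - t0) 1.
    by rewrite le_min; apply/andP; split; lra.
  have b1b : b1 <= b x by rewrite /b1 /b; lra.
  have bx : b x <= x by rewrite /b; lra.
  have bc : b x <= c by rewrite /b /c; lra.
  by rewrite (intf_split b1 (b x) x) // (intf_split b1 (b x) c) //; ring.
rewrite -[f t]subr0; apply: is_derive1B.
have [|df e] := @continuous_FTC1_closed R f b1 t (t + 1) _ (intf _ _ tb1) b1t (cf _ tt).
  by rewrite ltrDl.
by rewrite -e; exact: derivable_is_derive1.
Qed.

Lemma Rintegral_antiderivative F x y :
  (forall t, t0 < t -> is_derive t 1 F (f t)) -> t0 < x -> x <= y ->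
  (\int[mu]_(t in `[x, y]) f t)%R = F y - F x.
Proof.
move=> hF tx; rewrite le_eqVlt => /predU1P[<-|xy].
  by rewrite subrr set_itv1 Rintegral_set1.
have cF z : t0 < z -> {for z, continuous F}.
  by move=> /hF; exact: is_derive1_continuous.
rewrite /Rintegral (@continuous_FTC2 _ f F) //.
- exact: cf_within.
- split.
  + move=> z /[!in_itv] /= /andP[xz _].
    by have [] := hF z (lt_trans tx xz).
  + by apply: cvg_at_right_filter; exact: cF.
  + by apply: cvg_at_left_filter; apply: cF; exact: lt_trans xy.
- move=> z /[!in_itv] /= /andP[xz _].
  by apply: is_derive1_derive1; apply: hF; exact: lt_trans xz.
Qed.

End antiderivative.

(** * The scale factor near the singularity *)

Section generalized_trigonometry.
Context {R : realType}.

(** With [k] the square root of the absolute value of kappa, [sn x] is sinh (k x) / k, sin (k x) / k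
    or x according to the sign of kappa. The last two clauses are the two ways in which that sign
    enters the decay of a sn. *)
Lemma generalized_sine_exists (kappa : R) : exists sn cs : R -> R,
  [/\ forall x : R, is_derive x 1 sn (cs x),
      forall x : R, is_derive x 1 cs (- kappa * sn x),
      sn 0 = 0 & cs 0 = 1] /\
  (0 < kappa -> exists M, forall x, `|sn x| <= M) /\
  (kappa <= 0 -> forall x, 0 < cs x).
Proof.
case: (ltrgtP kappa 0) => [k0|k0|->].
- pose k := Num.sqrt (- kappa).
  have kk : - kappa = k ^+ 2 by rewrite sqr_sqrtr // oppr_ge0 ltW.
  have kn0 : k != 0 by rewrite gt_eqF // sqrtr_gt0 oppr_gt0.
  have dp (x : R) : is_derive x 1 (fun y => expR (k * y)) (expR (k * x) * k).
    apply: is_derive1_chain.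
    by rewrite -[X in is_derive _ _ _ X]mulr1; exact: is_derive1Z.
  have dm (x : R) : is_derive x 1 (fun y => expR (- k * y)) (expR (- k * x) * - k).
    apply: is_derive1_chain.
    by rewrite -[X in is_derive _ _ _ X]mulr1; exact: is_derive1Z.
  exists (fun x => (2 * k)^-1 * (expR (k * x) - expR (- k * x))).
  exists (fun x => 2^-1 * (expR (k * x) + expR (- k * x))).
  split; [split|split].
  + move=> x; have := is_derive1Z _ (2 * k)^-1 _ _ (is_derive1B _ _ _ _ _ (dp x) (dm x)).
    by move/is_derive_eq; apply; field.
  + move=> x; have := is_derive1Z _ 2^-1 _ _ (is_derive1D _ _ _ _ _ (dp x) (dm x)).
    by move/is_derive_eq; apply; rewrite kk; field.
  + by rewrite !mulr0 subrr mulr0.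
  + by rewrite !mulr0 expR0; field.
  + by [].
  + by move=> _ x; rewrite mulr_gt0 // addr_gt0 // expR_gt0.
- pose k := Num.sqrt kappa.
  have kk : kappa = k ^+ 2 by rewrite sqr_sqrtr // ltW.
  have k_gt0 : 0 < k by rewrite sqrtr_gt0.
  have kn0 : k != 0 by rewrite gt_eqF.
  have dk (x : R) : is_derive x 1 (fun y => k * y) k.
    by rewrite -[X in is_derive _ _ _ X]mulr1; exact: is_derive1Z.
  exists (fun x => k^-1 * sin (k * x)); exists (fun x => cos (k * x)).
  split; [split|split].
  + move=> x; have := is_derive1Z _ k^-1 _ _
      (is_derive1_chain _ _ _ _ _ (is_derive_sin (k * x)) (dk x)).
    by move/is_derive_eq; apply; field.
  + move=> x; have := is_derive1_chain _ _ _ _ _ (is_derive_cos (k * x)) (dk x).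
    by move/is_derive_eq; apply; rewrite kk; field.
  + by rewrite mulr0 sin0 mulr0.
  + by rewrite mulr0 cos0.
  + move=> _; exists k^-1 => x.
    rewrite normrM gtr0_norm ?invr_gt0 // ler_piMr ?invr_ge0 ?(ltW k_gt0) //.
    by rewrite ler_norml sin_geN1 sin_le1.
  + by [].
- exists id, (fun=> 1); split; [split|split] => //.
  + by move=> x; exact: is_derive_id.
  + by move=> x; rewrite oppr0 mul0r; exact: is_derive1C.
Qed.

End generalized_trigonometry.

(** * Regularity of the scale factor, and conformal time *)

Section scale_factor_theory.
Context {R : realType} {kappa t0 : R} {a : R -> R}.
Hypothesis ha : scale_factor t0 a.

Lemma scale_factor_gt0 t : t0 < t -> 0 < a t.
Proof. by case: ha => _ _ + _ _; apply. Qed.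

Lemma scale_factor_neq0 t : t0 < t -> a t != 0.
Proof. by move=> /scale_factor_gt0; rewrite lt0r => /andP[]. Qed.

Lemma scale_factor_cvg0 : a t @[t --> t0^'+] --> 0.
Proof. by case: ha => a0; rewrite a0. Qed.

Lemma is_derive_scale t : t0 < t -> is_derive t 1 a (derive1 a t).
Proof.
by case: ha => _ _ _ da _ /(da 0%N) h; exact: derivable_is_derive1.
Qed.

Lemma is_derive_scale1 t : t0 < t ->
  is_derive t 1 (derive1 a) (derive1n 2 a t).
Proof.
by case: ha => _ _ _ da _ /(da 1%N) h; exact: derivable_is_derive1.
Qed.

Lemma continuous_scale t : t0 < t -> {for t, continuous a}.
Proof. by move=> /is_derive_scale; exact: is_derive1_continuous. Qed.

Lemma continuous_scale2 t : t0 < t -> {for t, continuous (derive1n 2 a)}.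
Proof.
case: ha => _ _ _ da _ /(da 2%N) /derivable_is_derive1.
exact: is_derive1_continuous.
Qed.

Lemma continuous_hubble_term t : t0 < t ->
  {for t, continuous (fun t => (a t)^-1 * hubble_term kappa a t)}.
Proof.
move=> tt; have an := scale_factor_neq0 _ tt.
have ca := continuous_scale _ tt; have ca2 := continuous_scale2 _ tt.
have ca1 : {for t, continuous (derive1 a)}.
  exact: is_derive1_continuous (is_derive_scale1 _ tt).
have cV : {for t, continuous (fun t => (a t)^-1)} by apply: continuousV.
have ca_2 : {for t, continuous (fun t => (a t ^+ 2)^-1)}.
  apply: continuousV; first by rewrite expf_neq0.
  exact: (continuousM ca ca).
rewrite /hubble_term; apply: continuousM => //.
apply: continuousB; last by apply: continuousM => //; exact: cst_continuous.
apply: continuousB; first exact: continuousM.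
by apply: continuousM => //; exact: (continuousM ca1 ca1).
Qed.

(** [eta t] is the conformal time elapsed from [t] to [t2], oriented so as to be positive before
    [t2]. *)
Lemma conformal_time_exists t2 : exists2 eta : R -> R, eta t2 = 0 &
  forall t, t0 < t -> is_derive t 1 eta (- (a t)^-1).
Proof.
have cV t : t0 < t -> {for t, continuous (fun t => (a t)^-1)}.
  by move=> tt; apply: continuousV; [exact: scale_factor_neq0|exact: continuous_scale].
have [F hF] := antiderivative_exists _ _ cV.
exists (fun t => F t2 - F t); first by rewrite subrr.
move=> t /hF h; rewrite -sub0r; exact: is_derive1B.
Qed.

End scale_factor_theory.

(** * From the first integral condition to the decay of a sn *)

Section null_focusing.
Context {R : realType} {kappa t0 t1 : R} {a : R -> R}.
Hypothesis ha : scale_factor t0 a.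
Hypothesis ht1 : t0 < t1.
Hypothesis hint : (\int[lebesgue_measure]_(t' in `[t, t1])
               (a t' * \int[lebesgue_measure]_(t'' in `[t', t1])
                         ((a t'')^-1 * hubble_term kappa a t''))
            ) @[t --> t0^'+] --> -oo.

(** Rids the first condition of its integrals: the inner one is [Phi t1 - Phi t'] and the outer one
    [Psi t1 - Psi t], so divergence to minus infinity means that [Psi] tends to plus infinity at
    [t0]. *)
Lemma double_integral_antiderivatives : exists Phi Psi : R -> R,
  [/\ forall t, t0 < t -> is_derive t 1 Phi ((a t)^-1 * hubble_term kappa a t),
      forall t, t0 < t -> is_derive t 1 Psi (a t * (Phi t1 - Phi t))
    & forall r, \forall t \near t0^'+, r < Psi t].
Proof.
have ch := continuous_hubble_term ha (kappa := kappa).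
have [Phi hPhi] := antiderivative_exists _ _ ch.
have cP t : t0 < t -> {for t, continuous (fun t => a t * (Phi t1 - Phi t))}.
  move=> tt; apply: continuousM; first exact: continuous_scale ha _ tt.
  apply: continuousB; first exact: cst_continuous.
  exact: is_derive1_continuous (hPhi t tt).
have [Psi hPsi] := antiderivative_exists _ _ cP.
exists Phi, Psi; split => // r.
have h := (cvgrNyPlt _).1 hint (Psi t1 - r).
near=> t.
have tt : t0 < t by near: t; exact: nbhs_right_gt.
have tt1 : t < t1 by near: t; exact: nbhs_right_lt.
have : (\int[lebesgue_measure]_(t' in `[t, t1])
  (a t' * \int[lebesgue_measure]_(t'' in `[t', t1])
                         ((a t'')^-1 * hubble_term kappa a t'')))%R < Psi t1 - r.
  by near: t; exact: h.
rewrite (_ : (\int[_]_(t' in _) _)%R = Psi t1 - Psi t); first by lra.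
rewrite -(Rintegral_antiderivative _ _ cP Psi t t1 hPsi tt (ltW tt1)).
apply: eq_Rintegral => t'; rewrite inE /= in_itv /= => /andP[h1 h2].
by rewrite (Rintegral_antiderivative _ _ ch Phi) //; exact: lt_le_trans h1.
Unshelve. all: by end_near. Qed.

(* y = a sn(eta) satisfies y'' = q y along null geodesics; its logarithmic
   derivative v obeys the Riccati inequality v' <= q, and integrating twice
   towards t0 gives ln y <= const - Psi. *)
Lemma scale_sine_cvg0_nonpos (sn cs eta : R -> R) (t2 : R) :
  kappa <= 0 -> t0 < t2 ->
  (forall x : R, is_derive x 1 sn (cs x)) ->
  (forall x : R, is_derive x 1 cs (- kappa * sn x)) ->
  (forall t, t0 < t -> is_derive t 1 eta (- (a t)^-1)) ->
  (forall t, t0 < t < t2 -> 0 < sn (eta t)) ->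
  a t * sn (eta t) @[t --> t0^'+] --> 0.
Proof.
move=> k0 tt2 dsn dcs deta sn_gt0.
have [Phi [Psi [hPhi hPsi Psi_oo]]] := double_integral_antiderivatives.
have dS (t : R) : t0 < t ->
    is_derive t 1 (fun t => sn (eta t)) (cs (eta t) * - (a t)^-1).
  by move=> tt; exact: is_derive1_chain (dsn _) (deta _ tt).
have dC (t : R) : t0 < t ->
    is_derive t 1 (fun t => cs (eta t)) (- kappa * sn (eta t) * - (a t)^-1).
  by move=> tt; exact: is_derive1_chain (dcs _) (deta _ tt).
(* [N] is dy/dt, and [v] = N / (a y) is the logarithmic derivative of y with respect to the affine
   parameter for which dt/ds = 1/a, that is C = 1. *)
pose N t := derive1 a t * sn (eta t) - cs (eta t).
pose D t := a t ^+ 2 * sn (eta t).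
pose v t := N t * (D t)^-1.
have dv (t : R) : t0 < t < t2 ->
    is_derive t 1 v ((a t)^-1 * hubble_term kappa a t - a t * v t ^+ 2).
  move=> /andP[tt tlt]; have an := scale_factor_neq0 ha _ tt.
  have sn0 : sn (eta t) != 0 by rewrite gt_eqF // sn_gt0 // tt.
  have dN : is_derive t 1 N _ :=
    is_derive1B _ _ _ _ _ (is_derive1M _ _ _ _ _ (is_derive_scale1 ha _ tt)
      (dS t tt)) (dC t tt).
  have dD : is_derive t 1 D _ :=
    is_derive1M _ _ _ _ _ (is_derive1_sqr _ _ _ (is_derive_scale ha _ tt))
      (dS t tt).
  have Dn : D t != 0 by rewrite /D mulf_neq0 // expf_neq0.
  have := is_derive1M _ _ _ _ _ dN (is_derive1V _ _ _ Dn dD).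
  move/is_derive_eq; apply; rewrite /v /N /D /hubble_term.
  by field; rewrite an sn0.
have a_le1 : \forall t \near t0^'+, a t <= 1.
  have : \forall t \near t0^'+, `|a t| < 1.
    by have /cvgr0Pnorm_lt := scale_factor_cvg0 ha; apply.
  by apply: filterS => t /ltW; exact: le_trans (ler_norm _).
have [t3 [tt3 t32 h3]] : exists t3, [/\ t0 < t3, t3 < t2 &
    forall t, t0 < t <= t3 -> a t <= 1].
  have [d /= d0 hd] := a_le1.
  exists (t0 + Num.min d (t2 - t0) / 2).
  have m0 : 0 < Num.min d (t2 - t0) by rewrite lt_min d0 subr_gt0.
  have m1 : Num.min d (t2 - t0) <= d by rewrite ge_min lexx.
  have m2 : Num.min d (t2 - t0) <= t2 - t0 by rewrite ge_min lexx orbT.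
  split; [lra|lra|] => t /andP[tt tle]; apply: hd => //=.
  by rewrite ltr0_norm ?subr_lt0 //; lra.
(* The Riccati inequality says that [Phi - v] is nondecreasing, which bounds [v] from below by [Phi]
   up to a constant. *)
pose k := v t3 - Phi t3.
have v_ge t : t0 < t <= t3 -> k + Phi t <= v t.
  move=> /andP[tt tle].
  have h : Phi t - v t <= Phi t3 - v t3.
    apply: (@derive_ge0_le R (fun t => Phi t - v t) (fun t => a t * v t ^+ 2)
      t t3 tle) => z /andP[tz zt]; have z0 := lt_le_trans tt tz; last first.
      by rewrite mulr_ge0 ?sqr_ge0 // ltW // (scale_factor_gt0 ha).
    have hz : t0 < z < t2 by rewrite z0 (le_lt_trans zt).
    have := is_derive1B _ _ _ _ _ (hPhi z z0) (dv z hz).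
    by move/is_derive_eq; apply; ring.
  by rewrite /k; lra.
(* (ln y)' = a v is at least a (k + Phi), so (ln y)' + Psi' is at least a (Phi t1 + k), hence at
   least -K because a <= 1 up to [t3]. The linear term compensates for -K and makes [G]
   nondecreasing. *)
pose K := `|Phi t1 + k|.
pose G t := ln (a t * sn (eta t)) + (Psi t + K * t).
have y_gt0 t : t0 < t < t2 -> 0 < a t * sn (eta t).
  by move=> h; rewrite mulr_gt0 ?sn_gt0 // (scale_factor_gt0 ha) //; case/andP: h.
have G_le t : t0 < t <= t3 -> G t <= G t3.
  move=> /andP[tt tle].
  pose dG z := a z * v z + (a z * (Phi t1 - Phi z) + K).
  apply: (@derive_ge0_le R G dG t t3 tle) => z /andP[tz zt].
    have z0 : t0 < z by exact: lt_le_trans tz.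
    have z2 : z < t2 by exact: le_lt_trans t32.
    have hz : t0 < z < t2 by rewrite z0.
    have an := scale_factor_neq0 ha _ z0.
    have sn0 : sn (eta z) != 0 by rewrite gt_eqF // sn_gt0.
    have dln := is_derive1_chain (@ln R) (fun t => a t * sn (eta t)) _ _ _ (is_derive1_ln (y_gt0 z hz))
      (is_derive1M _ _ _ _ _ (is_derive_scale ha _ z0) (dS z z0)).
    have dK : is_derive z 1 (fun t => K * t) K.
      by rewrite -[X in is_derive _ _ _ X]mulr1; exact: is_derive1Z.
    have := is_derive1D _ _ _ _ _ dln (is_derive1D _ _ _ _ _ (hPsi z z0) dK).
    move/is_derive_eq; apply; rewrite /dG /v /N /D; congr (_ + _).
    by field; rewrite an sn0.
  have hz : t0 < z <= t3 by rewrite (lt_le_trans tt tz).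
  have az := h3 _ hz.
  have a0 : 0 < a z by apply: (scale_factor_gt0 ha); case/andP: hz.
  have h1 : a z * (k + Phi z) <= a z * v z by rewrite ler_pM2l // v_ge.
  have h2 : - K <= a z * (Phi t1 + k).
    have : `|a z * (Phi t1 + k)| <= K.
      by rewrite normrM (gtr0_norm a0) ler_piMl.
    by rewrite ler_norml => /andP[].
  rewrite /dG; nra.
apply/cvgr0Pnorm_lt => e e0.
near=> t.
have tt : t0 < t by near: t; exact: nbhs_right_gt.
have tt3' : t <= t3 by near: t; exact: nbhs_right_le.
have ht : t0 < t < t2 by rewrite tt /=; exact: le_lt_trans t32.
rewrite gtr0_norm ?y_gt0 // -ltr_ln ?posrE ?y_gt0 //.
have := G_le t; rewrite tt tt3' => /(_ isT); rewrite {1}/G.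
(* Together with [G t <= G t3] and [K * t0 <= K * t], this lower bound on [Psi t] gives ln y < ln
   e. *)
have hP : G t3 - K * t0 - ln e < Psi t by near: t; exact: Psi_oo.
have : K * t0 <= K * t by rewrite ler_wpM2l ?normr_ge0 // ltW.
by move: hP; lra.
Unshelve. all: by end_near. Qed.

(** [H] stands for the comoving distance to the base point and [g] for its rate. If kappa > 0, [sn]
    is bounded and [a] tends to 0. Otherwise [g <= 1 / a] gives 0 <= H <= eta before [t2]; as [sn]
    is nondecreasing, a sn(H) is squeezed between 0 and its null counterpart a sn(eta). *)
Lemma scale_sine_cvg0 (sn cs H g : R -> R) (t2 : R) : t0 < t2 ->
  [/\ forall x : R, is_derive x 1 sn (cs x),
      forall x : R, is_derive x 1 cs (- kappa * sn x),
      sn 0 = 0 & cs 0 = 1] ->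
  (0 < kappa -> exists M, forall x, `|sn x| <= M) ->
  (kappa <= 0 -> forall x, 0 < cs x) ->
  H t2 = 0 -> (forall t, t0 < t -> is_derive t 1 H (- g t)) ->
  (forall t, t0 < t -> 0 <= g t <= (a t)^-1) ->
  a t * sn (H t) @[t --> t0^'+] --> 0.
Proof.
move=> tt2 [dsn dcs sn0 cs0] sn_bounded cs_gt0 H0 dH g_le.
case: (ltP 0 kappa) => [k0|k0].
  have [M hM] := sn_bounded k0.
  have cM : a t * M @[t --> t0^'+] --> 0.
    by rewrite -[X in _ --> X](mul0r M); apply: cvgMl; exact: scale_factor_cvg0.
  apply/norm_cvg0P; apply: (@squeeze_cvgr _ _ _ _ (fun=> 0) (fun t => a t * M)) => //.
    near=> t; rewrite normr_ge0 /= normrM gtr0_norm.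
      rewrite ler_wpM2l // ltW //.
      by apply: (scale_factor_gt0 ha); near: t; exact: nbhs_right_gt.
    by apply: (scale_factor_gt0 ha); near: t; exact: nbhs_right_gt.
  exact: cvg_cst.
have [eta eta0 deta] := conformal_time_exists ha t2.
have sn_mono x y : x <= y -> sn x <= sn y.
  move=> xy; apply: (@derive_ge0_le R sn cs x y xy) => z _.
  exact/ltW/cs_gt0.
have sn_gt0 x : 0 < x -> 0 < sn x.
  move=> x0; rewrite lt_neqAle -{2}sn0 sn_mono ?ltW // andbT eq_sym.
  (* Monotonicity only gives [0 <= sn x]; equality would produce a zero of [cs] by Rolle's
     theorem. *)
  apply/eqP => snx.
  have [z /[!in_itv] /= /andP[z0 zx]] := @Rolle R sn 0 x x0
    (fun z _ => is_derive1_derivable _ _ _ (dsn z))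
    (@derivable_within_continuous _ _ _ `[0, x] (fun z _ => is_derive1_derivable _ _ _ (dsn z)))
    (etrans sn0 (esym snx)).
  move=> dz; have := cs_gt0 k0 z.
  by rewrite -(is_derive1_derive1 _ _ _ (dsn z)) (is_derive1_derive1 _ _ _ dz) ltxx.
have eta_gt0 t : t0 < t < t2 -> 0 < eta t.
  move=> /andP[tt tlt].
  have [||z] := @MVT R eta (fun t => - (a t)^-1) t t2 tlt.
  - by move=> z /[!in_itv] /= /andP[tz _]; apply: deta; exact: lt_trans tz.
  - apply: (@derivable_within_continuous _ _ _ `[t, t2]) => z.
    by rewrite in_itv /= => /andP[tz _]; case: (deta z (lt_le_trans tt tz)).
  rewrite in_itv /= eta0 => /andP[tz _] e.
  have : 0 < (a z)^-1 * (t2 - t).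
    by rewrite mulr_gt0 ?subr_gt0 // invr_gt0 (scale_factor_gt0 ha) // (lt_trans tt).
  by move: e; lra.
have key := @scale_sine_cvg0_nonpos sn cs eta t2 k0 tt2 dsn dcs deta
  (fun t ht => sn_gt0 _ (eta_gt0 t ht)).
apply: (@squeeze_cvgr _ _ _ _ (fun=> 0) (fun t => a t * sn (eta t))) => //; last exact: cvg_cst.
near=> t.
have tt : t0 < t by near: t; exact: nbhs_right_gt.
have tlt : t <= t2 by near: t; exact: nbhs_right_le.
have a0 := scale_factor_gt0 ha _ tt.
have Hge0 : 0 <= H t.
  rewrite -H0 -lerN2.
  apply: (@derive_ge0_le R (fun t => - H t) g t t2 tlt) => z /andP[tz _].
    by rewrite -[g z]opprK; apply: is_derive1N; apply: dH; exact: lt_le_trans tz.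
  by case/andP: (g_le z (lt_le_trans tt tz)).
have Hle : H t <= eta t.
  have : H t - eta t <= H t2 - eta t2.
    apply: (@derive_ge0_le R (fun t => H t - eta t) (fun t => - g t - - (a t)^-1) t t2 tlt) => z /andP[tz _].
      by apply: is_derive1B; [apply: dH|apply: deta]; exact: lt_le_trans tz.
    by case/andP: (g_le z (lt_le_trans tt tz)) => _; lra.
  by rewrite H0 eta0; lra.
rewrite ler_pM2l // sn_mono // andbT mulr_ge0 ?(ltW a0) // -sn0.
exact: sn_mono.
Unshelve. all: by end_near. Qed.

End null_focusing.

(** * Wronskians and the scalar Jacobi equations *)

Lemma wronskian_constant {R : realType} (D : set R) (f f1 g g1 q : R -> R)
    (s s' : R) : is_interval D -> D s -> D s' ->
  (forall u, D u -> is_derive u 1 f (f1 u)) ->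
  (forall u, D u -> is_derive u 1 f1 (q u * f u)) ->
  (forall u, D u -> is_derive u 1 g (g1 u)) ->
  (forall u, D u -> is_derive u 1 g1 (q u * g u)) ->
  f s * g1 s - f1 s * g s = f s' * g1 s' - f1 s' * g s'.
Proof.
move=> iD Ds Ds' df df1 dg dg1.
(* The equation y'' = q y has no first-order term, so in the derivative of the Wronskian the
   products of first derivatives cancel, and so do the two terms in [q]. *)
apply: (@derive_eq0_interval R (fun u => f u * g1 u - f1 u * g u) D) => // u Du.
have := is_derive1B _ _ _ _ _ (is_derive1M _ _ _ _ _ (df u Du) (dg1 u Du))
  (is_derive1M _ _ _ _ _ (df1 u Du) (dg u Du)).
by move/is_derive_eq; apply; ring.
Qed.

Section jacobi_solutions.
Context {R : realType} {kappa t0 t1 : R} {a : R -> R}.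
Hypothesis ha : scale_factor t0 a.
Hypothesis ht1 : t0 < t1.
Hypothesis hint : (\int[lebesgue_measure]_(t' in `[t, t1])
               (a t' * \int[lebesgue_measure]_(t'' in `[t', t1])
                         ((a t'')^-1 * hubble_term kappa a t''))
            ) @[t --> t0^'+] --> -oo.
Context {eps C : R} {D : set R} {T tau : R -> R} {s2 : R}.
Hypothesis heps : eps = -1 \/ eps = 0.
Hypothesis hC : 0 < C.
Hypothesis iD : is_interval D.
Hypothesis Ds2 : D s2.
Hypothesis T_gt : forall s, D s -> t0 < T s.
Hypothesis T_onto : forall t, t0 < t <= T s2 -> (T @` D) t.
Hypothesis tauT : forall s, D s -> tau (T s) = s.

(* dt/dtau = speed t / a t *)
Definition speed t : R := Num.sqrt (C - eps * a t ^+ 2).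
Hypothesis dT : forall s, D s -> is_derive s 1 T (speed (T s) / a (T s)).

Let eps_le0 : eps <= 0.
Proof. by case: heps => ->; rewrite ?oppr_le0 ?ler01. Qed.

Let C_le t : C <= C - eps * a t ^+ 2.
Proof. by rewrite lerDl oppr_ge0 mulr_le0_ge0 ?sqr_ge0. Qed.

Lemma speed_sqr t : speed t ^+ 2 = C - eps * a t ^+ 2.
Proof. by rewrite sqr_sqrtr // (le_trans (ltW hC)). Qed.

Lemma speed_gt0 t : 0 < speed t.
Proof. by rewrite sqrtr_gt0 (lt_le_trans hC). Qed.

Let speed_neq0 t : speed t != 0.
Proof. by rewrite gt_eqF // speed_gt0. Qed.

Lemma is_derive_speed t : t0 < t ->
  is_derive t 1 speed (- eps * a t * derive1 a t / speed t).
Proof.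
move=> tt.
have pos : 0 < C - eps * a t ^+ 2 by rewrite (lt_le_trans hC).
have := is_derive1_chain (@Num.sqrt R) (fun t => C - eps * a t ^+ 2) _ _ _
  (is_derive1_sqrt pos) (is_derive1B _ _ _ _ _ (is_derive1C C t)
    (is_derive1Z _ eps _ _ (is_derive1_sqr _ _ _ (is_derive_scale ha _ tt)))).
move/is_derive_eq; apply; rewrite -/(speed t).
by field; exact: speed_neq0.
Qed.

Let dfT (f : R -> R) (df s : R) : D s -> is_derive (T s) 1 f df ->
  is_derive s 1 (fun s => f (T s)) (df * (speed (T s) / a (T s))).
Proof. by move=> Ds hf; exact: is_derive1_chain hf (dT s Ds). Qed.

(** [T] is strictly increasing by the mean value theorem, so a time not after [T s2] cannot be
    reached at a parameter beyond [s2]. *)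
Lemma tau_spec t : t0 < t <= T s2 -> [/\ D (tau t), T (tau t) = t & tau t <= s2].
Proof.
move=> ht; have [s Ds Ts] := T_onto _ ht.
have -> : tau t = s by rewrite -Ts tauT.
split => //; rewrite leNgt; apply/negP => s2s.
have : T s2 < T s.
  have Dz z : s2 <= z <= s -> D z by exact: is_interval_segment.
  have [||z] := @MVT R T (fun s => speed (T s) / a (T s)) s2 s s2s.
  - by move=> z /[!in_itv] /= /andP[h1 h2]; apply: dT; apply: Dz; rewrite !ltW.
  - apply: (@derivable_within_continuous _ _ _ `[s2, s]) => z.
    by rewrite in_itv => /Dz /dT; exact: is_derive1_derivable.
  rewrite in_itv /= => /andP[h1 h2] e; rewrite -subr_gt0 e mulr_gt0 ?subr_gt0 //.
  by rewrite divr_gt0 ?speed_gt0 // (scale_factor_gt0 ha) //; apply: T_gt; apply: Dz; rewrite !ltW.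
by rewrite Ts; case/andP: ht => _; rewrite leNgt => /negbTE ->.
Qed.

Let near_tau : \forall t \near t0^'+, t0 < t <= T s2.
Proof.
near=> t; apply/andP; split; near: t; first exact: nbhs_right_gt.
by apply: nbhs_right_le; exact: T_gt.
Unshelve. all: by end_near. Qed.

(** The coefficient q of y'' = q y in the directions orthogonal to both d/dt and gamma'. *)
Definition transverse_coef t : R :=
  - eps * (derive1n 2 a t / a t) + C / a t ^+ 2 * hubble_term kappa a t.

(* Two explicit solutions are a sn(chi) and a cs(chi), chi being the comoving
   distance to the base point; they come from the rotations about it and from
   the transvections through it. *)
Lemma transverse_jacobi_cvg0 (B B1 : R -> R) :
  (forall s, D s -> is_derive s 1 B (B1 s)) ->
  (forall s, D s -> is_derive s 1 B1 (transverse_coef (T s) * B s)) ->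
  B s2 = 0 -> B (tau t) @[t --> t0^'+] --> 0.
Proof.
move=> dB dB1 B0.
have [sn [cs [hsc [sn_bounded cs_gt0]]]] := generalized_sine_exists kappa.
have [dsn dcs sn0 cs0] := hsc.
pose c := Num.sqrt C.
have cC : C = c ^+ 2 by rewrite sqr_sqrtr // ltW.
have c_gt0 : 0 < c by rewrite sqrtr_gt0.
have cn0 : c != 0 by rewrite gt_eqF.
have c_le t : c <= speed t by rewrite ler_wsqrtr.
(* The comoving speed c / a^2 in the affine parameter, divided by dt/ds = speed / a. Its integral
   [H] from [t] to [T s2] is therefore the distance chi. *)
pose g t := c / (a t * speed t).
have cg t : t0 < t -> {for t, continuous g}.
  move=> tt; apply: continuousM; first exact: cst_continuous.
  apply: continuousV; first by rewrite mulf_neq0 ?(scale_factor_neq0 ha) // speed_neq0.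
  apply: continuousM; first exact: (continuous_scale ha).
  exact: is_derive1_continuous (is_derive_speed _ tt).
have [F dF] := antiderivative_exists _ _ cg.
pose H t := F (T s2) - F t.
have H0 : H (T s2) = 0 by rewrite /H subrr.
have dH (t : R) : t0 < t -> is_derive t 1 H (- g t).
  by move=> /dF h; rewrite -sub0r; apply: is_derive1B.
have id1 x : cs x ^+ 2 + kappa * sn x ^+ 2 = 1.
  have -> : 1 = cs 0 ^+ 2 + kappa * sn 0 ^+ 2 by rewrite cs0 sn0; ring.
  apply: (@is_derive_0_is_cst R (fun x => cs x ^+ 2 + kappa * sn x ^+ 2)) => y.
  have := is_derive1D _ _ _ _ _ (is_derive1_sqr _ _ _ (dcs y))
    (is_derive1Z _ kappa _ _ (is_derive1_sqr _ _ _ (dsn y))).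
  by move/is_derive_eq; apply; ring.
have dsnH (t : R) : t0 < t -> is_derive t 1 (fun t => sn (H t)) (cs (H t) * - g t).
  by move=> tt; exact: is_derive1_chain (dsn _) (dH _ tt).
have dcsH (t : R) : t0 < t ->
    is_derive t 1 (fun t => cs (H t)) (- kappa * sn (H t) * - g t).
  by move=> tt; exact: is_derive1_chain (dcs _) (dH _ tt).
pose r t := derive1 a t * speed t * (a t)^-1.
have dVa (t : R) : t0 < t -> is_derive t 1 (fun t => (a t)^-1) _ :=
  fun tt => is_derive1V _ _ _ (scale_factor_neq0 ha _ tt) (is_derive_scale ha _ tt).
have dr (t : R) : t0 < t -> is_derive t 1 r _ :=
  fun tt => is_derive1M _ _ _ _ _ (is_derive1M _ _ _ _ _ (is_derive_scale1 ha _ tt)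
    (is_derive_speed _ tt)) (dVa _ tt).
(* [z1] and [z2] are the two explicit solutions as functions of time; [y1] and [y2] are their
   derivatives with respect to the affine parameter. *)
pose z1 t := a t * sn (H t).
pose z2 t := a t * cs (H t).
pose y1 t := r t * sn (H t) - c * (cs (H t) * (a t)^-1).
pose y2 t := r t * cs (H t) + kappa * c * (sn (H t) * (a t)^-1).
(* Expressing [eps] through [speed] turns the second-order equations of [z1] and [z2] into rational
   identities in which the square root is a free variable. *)
have epsE t : t0 < t -> eps = (c ^+ 2 - speed t ^+ 2) / a t ^+ 2.
  move=> tt; rewrite speed_sqr cC; field; exact: scale_factor_neq0 ha _ tt.
have dz1 (s : R) : D s -> is_derive s 1 (fun s => z1 (T s)) (y1 (T s)).
  move=> Ds; have tt := T_gt _ Ds; have an := scale_factor_neq0 ha _ tt.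
  have := dfT _ _ _ Ds (is_derive1M _ _ _ _ _ (is_derive_scale ha _ tt) (dsnH _ tt)).
  by move/is_derive_eq; apply; rewrite /y1 /r /g; field; rewrite an speed_neq0.
have dz2 (s : R) : D s -> is_derive s 1 (fun s => z2 (T s)) (y2 (T s)).
  move=> Ds; have tt := T_gt _ Ds; have an := scale_factor_neq0 ha _ tt.
  have := dfT _ _ _ Ds (is_derive1M _ _ _ _ _ (is_derive_scale ha _ tt) (dcsH _ tt)).
  by move/is_derive_eq; apply; rewrite /y2 /r /g; field; rewrite an speed_neq0.
have dy1 (s : R) : D s -> is_derive s 1 (fun s => y1 (T s)) (transverse_coef (T s) * z1 (T s)).
  move=> Ds; have tt := T_gt _ Ds; have an := scale_factor_neq0 ha _ tt.
  have := dfT _ _ _ Ds (is_derive1B _ _ _ _ _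
    (is_derive1M _ _ _ _ _ (dr _ tt) (dsnH _ tt))
    (is_derive1Z _ c _ _ (is_derive1M _ _ _ _ _ (dcsH _ tt) (dVa _ tt)))).
  move/is_derive_eq; apply; rewrite /transverse_coef /hubble_term /z1 /r /g.
  by rewrite (epsE _ tt) cC; field; rewrite an speed_neq0.
have dy2 (s : R) : D s -> is_derive s 1 (fun s => y2 (T s)) (transverse_coef (T s) * z2 (T s)).
  move=> Ds; have tt := T_gt _ Ds; have an := scale_factor_neq0 ha _ tt.
  have := dfT _ _ _ Ds (is_derive1D _ _ _ _ _
    (is_derive1M _ _ _ _ _ (dr _ tt) (dcsH _ tt))
    (is_derive1Z _ (kappa * c) _ _ (is_derive1M _ _ _ _ _ (dsnH _ tt) (dVa _ tt)))).
  move/is_derive_eq; apply; rewrite /transverse_coef /hubble_term /z2 /r /g.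
  by rewrite (epsE _ tt) cC; field; rewrite an speed_neq0.
(* The Wronskian of [z1] and [B] is zero because both vanish at [s2], and that of [z2] and [z1] is
   [- c]. Hence [B] is a multiple of [z1]; the factor comes from the Wronskian of [z2] and [B],
   evaluated at [s2]. *)
pose k := - (z2 (T s2) * B1 s2) / c.
have Bz s : D s -> B s = k * z1 (T s).
  move=> Ds.
  have w1 := wronskian_constant D _ _ _ _ (fun s => transverse_coef (T s)) s s2 iD Ds Ds2 dz1 dy1 dB dB1.
  have w2 := wronskian_constant D _ _ _ _ (fun s => transverse_coef (T s)) s s2 iD Ds Ds2 dz2 dy2 dB dB1.
  rewrite B0 {2}/z1 H0 sn0 !mulr0 !mul0r subr0 in w1.
  rewrite B0 mulr0 subr0 in w2.
  have w3 : z2 (T s) * y1 (T s) - z1 (T s) * y2 (T s) = - c.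
    have an := scale_factor_neq0 ha _ (T_gt _ Ds).
    rewrite -[c in RHS]mulr1 -(id1 (H (T s))) /z1 /z2 /y1 /y2.
    by field.
  rewrite /k -w2; apply: (mulIf cn0); rewrite mulrAC divfK //.
  transitivity (- z2 (T s) * (z1 (T s) * B1 s - y1 (T s) * B s)
    - B s * (z2 (T s) * y1 (T s) - z1 (T s) * y2 (T s))); last by ring.
  by rewrite w1 w3; ring.
have g_le t : t0 < t -> 0 <= g t <= (a t)^-1.
  move=> tt; have a0 := scale_factor_gt0 ha _ tt; have s0 := speed_gt0 t.
  rewrite /g; apply/andP; split; first by rewrite divr_ge0 ?mulr_ge0 // ltW.
  by rewrite invfM mulrCA ler_piMr ?invr_ge0 ?(ltW a0) // ler_pdivrMr // mul1r.
have z1_0 := scale_sine_cvg0 ha ht1 hint sn cs H g (T s2) (T_gt _ Ds2) hsc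
  sn_bounded cs_gt0 H0 dH g_le.
have kz : k * z1 t @[t --> t0^'+] --> 0.
  by rewrite -[X in _ --> X](mulr0 k); apply: cvgMr.
apply: cvg_trans kz; apply: near_eq_cvg.
apply: filterS near_tau => t /tau_spec [Dt Tt _].
by rewrite (Bz _ Dt) Tt.
Qed.

(** For eps = -1 the function [speed] = sqrt (C + a^2) is itself a solution, with derivative a' in
    the affine parameter. The constant Wronskian [k] then yields (y / speed)' = k / speed^2, which
    is integrated from [s2] towards the singularity. *)
Lemma radial_jacobi_bounded (y y' : R -> R) : eps = -1 ->
  (forall s, D s -> is_derive s 1 y (y' s)) ->
  (forall s, D s -> is_derive s 1 y' (derive1n 2 a (T s) / a (T s) * y s)) ->
  y s2 = 0 -> exists M, \forall t \near t0^'+, `|y (tau t)| <= M.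
Proof.
move=> eps1 dy dy' y0.
have dw (s : R) : D s -> is_derive s 1 (fun s => speed (T s)) (derive1 a (T s)).
  move=> Ds; have tt := T_gt _ Ds; have an := scale_factor_neq0 ha _ tt.
  have := dfT _ _ _ Ds (is_derive_speed _ tt).
  by move/is_derive_eq; apply; rewrite eps1; field; rewrite an speed_neq0.
have dw1 (s : R) : D s -> is_derive s 1 (fun s => derive1 a (T s))
    (derive1n 2 a (T s) / a (T s) * speed (T s)).
  move=> Ds; have tt := T_gt _ Ds.
  have := dfT _ _ _ Ds (is_derive_scale1 ha _ tt).
  by move/is_derive_eq; apply; ring.
pose k := speed (T s2) * y' s2.
have w s : D s -> speed (T s) * y' s - derive1 a (T s) * y s = k.
  move=> Ds.
  have := wronskian_constant D _ _ _ _ (fun s => derive1n 2 a (T s) / a (T s))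
    s s2 iD Ds Ds2 dw dw1 dy dy'.
  by move=> ->; rewrite y0 mulr0 subr0.
(* From C <= speed^2 and a <= speed, the derivative of y / speed is at most [m] times dT/ds in
   absolute value, so the elapsed time controls the growth. *)
pose m := `|k| / C.
have bnd s : D s -> s <= s2 -> `|y s / speed (T s)| <= m * (T s2 - T s).
  move=> Ds ss2.
  have := @derive_le_ge0_interval R (fun s => y s / speed (T s)) (fun s => m * T s)
    (fun s => k / speed (T s) ^+ 2) (fun s => m * (speed (T s) / a (T s))) D s s2
    iD Ds Ds2 ss2.
  rewrite y0 mul0r sub0r normrN mulrBr; apply.
  - move=> z Dz.
    have := is_derive1M _ _ _ _ _ (dy z Dz) (is_derive1V (fun s => speed (T s)) _ _ (speed_neq0 _) (dw z Dz)).
    by move/is_derive_eq; apply; rewrite -(w z Dz); field; rewrite speed_neq0.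
  - by move=> z Dz; apply: is_derive1Z; exact: dT.
  - move=> z Dz; set t := T z; have s0 := speed_gt0 t.
    have a0 : 0 < a t by apply: (scale_factor_gt0 ha); exact: T_gt.
    have sa : a t <= speed t.
      rewrite -ler_sqr ?nnegrE ?(ltW a0) ?(ltW s0) // speed_sqr eps1.
      by move: hC; lra.
    have sC : C <= speed t ^+ 2 by rewrite speed_sqr C_le.
    have s20 : 0 < speed t ^+ 2 by rewrite exprn_gt0.
    rewrite normrM normfV (gtr0_norm s20) /m -mulrA ler_wpM2l //.
    apply: (@le_trans _ _ C^-1); first by rewrite lef_pV2 ?posrE.
    by rewrite ler_peMr ?invr_ge0 ?(ltW hC) // ler_pdivlMr // mul1r.
(* The elapsed time is at most [T s2 - t0], and speed <= C + 1 as soon as a <= 1. *)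
exists (m * (T s2 - t0) * (C + 1)).
have a_le1 : \forall t \near t0^'+, `|a t| < 1.
  by have /cvgr0Pnorm_lt := scale_factor_cvg0 ha; apply.
near=> t.
have ht : t0 < t <= T s2 by near: t; exact: near_tau.
have [Dt Tt lt2] := tau_spec _ ht.
have tt : t0 < t by case/andP: ht.
have := bnd _ Dt lt2; rewrite Tt normrM normfV (gtr0_norm (speed_gt0 t)).
rewrite ler_pdivrMr ?speed_gt0 // => /le_trans; apply.
have m0 : 0 <= m by rewrite divr_ge0 // ltW.
have sle : speed t <= C + 1.
  have C1 : 0 <= C + 1 by rewrite addr_ge0 // ltW.
  rewrite -ler_sqr ?nnegrE ?(ltW (speed_gt0 t)) // speed_sqr eps1.
  have : a t ^+ 2 <= 1.
    have : `|a t| < 1 by near: t.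
    by move=> h; rewrite -real_normK ?num_real // expr_le1 // ltW.
  by move: hC; nra.
have d0 : 0 <= T s2 - t by rewrite subr_ge0; case/andP: ht.
apply: ler_pM => //; [by rewrite mulr_ge0|by rewrite ltW // speed_gt0|].
by rewrite ler_wpM2l //; lra.
Unshelve. all: by end_near. Qed.

End jacobi_solutions.

(** * Connection and curvature of the FLRW metric *)

Section coordinates.
Context {R : realType}.

(** The four indices are explicit ordinals so that matches on their values, as in [metric_jets] and
    [christoffel_jets], reduce by computation. *)
Definition o0 : 'I_(1 + 3) := @Ordinal (1 + 3) 0 isT.
Definition o1 : 'I_(1 + 3) := @Ordinal (1 + 3) 1 isT.
Definition o2 : 'I_(1 + 3) := @Ordinal (1 + 3) 2 isT.
Definition o3 : 'I_(1 + 3) := @Ordinal (1 + 3) 3 isT.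

Lemma ord4P (P : 'I_(1 + 3) -> Prop) :
  P o0 -> P o1 -> P o2 -> P o3 -> forall i, P i.
Proof.
move=> p0 p1 p2 p3 [[|[|[|[|n]]]] hn] //.
- by rewrite (_ : Ordinal hn = o0) //; apply: val_inj.
- by rewrite (_ : Ordinal hn = o1) //; apply: val_inj.
- by rewrite (_ : Ordinal hn = o2) //; apply: val_inj.
- by rewrite (_ : Ordinal hn = o3) //; apply: val_inj.
Qed.

Lemma sum_ord4 (V : nmodType) (F : 'I_(1 + 3) -> V) :
  \sum_(i < 1 + 3) F i = F o0 + F o1 + F o2 + F o3.
Proof.
rewrite !big_ord_recr big_ord0 /= add0r; congr (F _ + F _ + F _ + F _);
  exact: val_inj.
Qed.

(* The metric coefficients and the Christoffel symbols are products of a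
   function of t, one of r and one of theta; a jet is such a factor together
   with its derivative. *)
Definition jet : Type := ((R -> R) * (R -> R))%type.

Definition is_jet (j : jet) (x : R) := is_derive x 1 j.1 (j.2 x).

Definition separated (p : jet * jet * jet) (x : 'rV[R]_(1 + 3)) : R :=
  p.1.1.1 (x 0 o0) * p.1.2.1 (x 0 o1) * p.2.1 (x 0 o2).

(** The default value 0 is the derivative along phi, on which a separated function does not
    depend. *)
Definition separated_partial (m : nat) (p : jet * jet * jet)
    (x : 'rV[R]_(1 + 3)) : R :=
  match m with
  | 0%N => p.1.1.2 (x 0 o0) * p.1.2.1 (x 0 o1) * p.2.1 (x 0 o2)
  | 1%N => p.1.1.1 (x 0 o0) * p.1.2.2 (x 0 o1) * p.2.1 (x 0 o2)
  | 2%N => p.1.1.1 (x 0 o0) * p.1.2.1 (x 0 o1) * p.2.2 (x 0 o2)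
  | _ => 0
  end.

Lemma derive_along_line n (f : 'rV[R]_n -> R) (x v : 'rV[R]_n) (d : R) :
  is_derive (0 : R) 1 (fun h : R => f (h *: v + x)) d -> 'D_v f x = d.
Proof.
move=> /is_derive1_derive1 <-; rewrite /derive1 /derive.
suff -> : (fun h : R => h^-1 *: ((f \o shift x) (h *: v) - f x)) =
  (fun h : R => h^-1 *: (f ((h + 0) *: v + x) - f (0 *: v + x))) by [].
by apply/funext => h /=; rewrite addr0 scale0r add0r.
Qed.

(** On the line through [x] in direction [m], the coordinate [i] is affine with slope 1 if [i = m]
    and 0 otherwise, so the product rule keeps a single term. *)
Lemma partial_separated (p : jet * jet * jet) (x : 'rV[R]_(1 + 3)) m :
  is_jet p.1.1 (x 0 o0) -> is_jet p.1.2 (x 0 o1) -> is_jet p.2 (x 0 o2) ->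
  partial m (separated p) x = separated_partial m p x.
Proof.
move=> h0 h1 h2; rewrite /partial; apply: derive_along_line.
have dl (i : 'I_(1 + 3)) :
    is_derive (0 : R) 1 (fun h : R => (h *: delta_mx 0 m + x) 0 i) (m == i)%:R.
  have -> : (fun h : R => (h *: delta_mx 0 m + x) 0 i) =
            (fun h => (m == i)%:R * h + x 0 i).
    by apply/funext => h; rewrite !mxE /= eq_sym mulrC.
  have := is_derive1D _ _ _ _ _ (is_derive1Z _ (m == i)%:R _ _ (is_derive_id (0 : R) 1))
    (is_derive1C (x 0 i) 0).
  by move/is_derive_eq; apply; rewrite mulr1 addr0.
have e i : (0 *: delta_mx 0 m + x) 0 i = x 0 i by rewrite scale0r add0r.
have c (j : jet) i : is_jet j (x 0 i) ->
    is_derive (0 : R) 1 (fun h : R => j.1 ((h *: delta_mx 0 m + x) 0 i))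
      (j.2 (x 0 i) * (m == i)%:R).
  move=> hj; apply: (is_derive1_chain j.1 _ _ _ _ _ (dl i)).
  by rewrite e.
have := is_derive1M _ _ _ _ _ (is_derive1M _ _ _ _ _ (c _ _ h0) (c _ _ h1)) (c _ _ h2).
move/is_derive_eq; apply; rewrite !e.
by move: m {dl e c}; apply: ord4P; rewrite /=; ring.
Qed.

End coordinates.

(** * Tables of the metric coefficients and of the connection coefficients *)

Section flrw_connection.
Context {R : realType} {kappa t0 : R} {a : R -> R}.
Hypothesis ha : scale_factor t0 a.

Local Notation a1 := (derive1 a).
Local Notation a2 := (derive1n 2 a).
Local Notation jet := (@jet R).

(** In this and the following jets the derivatives stand exactly as the differentiation rules
    produce them, with factors 1 and summands 0 left in place, so that their validity is a direct
    application of those rules. *)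
Definition jet0 : jet := (fun=> 0, fun=> 0).
Definition jet1 : jet := (fun=> 1, fun=> 0).
Definition jetN1 : jet := (fun=> - 1, fun=> 0).
Definition jet_scale_sqr : jet := (fun t => a t ^+ 2, fun t => 2 * a t * a1 t).
Definition jet_scaleM : jet :=
  (fun t => a t * a1 t, fun t => a1 t * a1 t + a t * a2 t).
Definition jet_hubble : jet :=
  (fun t => a1 t * (a t)^-1,
   fun t => a2 t * (a t)^-1 + a1 t * (- a1 t / a t ^+ 2)).
Definition jet_radial : jet :=
  (fun r => (1 - kappa * r ^+ 2)^-1,
   fun r => - (0 - kappa * (2 * r * 1)) / (1 - kappa * r ^+ 2) ^+ 2).
Definition jet_sqr : jet := (fun r => r ^+ 2, fun r => 2 * r * 1).
Definition jet_kradial : jet :=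
  (fun r => kappa * r * (1 - kappa * r ^+ 2)^-1,
   fun r => kappa * 1 * (1 - kappa * r ^+ 2)^-1 +
     kappa * r * (- (0 - kappa * (2 * r * 1)) / (1 - kappa * r ^+ 2) ^+ 2)).
Definition jet_bend : jet :=
  (fun r => - (r * (1 - kappa * r ^+ 2)),
   fun r => - (1 * (1 - kappa * r ^+ 2) + r * (0 - kappa * (2 * r * 1)))).
Definition jet_inv : jet := (fun r => r^-1, fun r => - 1 / r ^+ 2).
Definition jet_sin_sqr : jet :=
  (fun u => sin u ^+ 2, fun u => 2 * sin u * cos u).
Definition jet_sincos : jet :=
  (fun u => - (sin u * cos u), fun u => - (cos u * cos u + sin u * - sin u)).
Definition jet_cot : jet :=
  (fun u => cos u * (sin u)^-1,
   fun u => - sin u * (sin u)^-1 + cos u * (- cos u / sin u ^+ 2)).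

Definition metric_jets (i : nat) : jet * jet * jet :=
  match i with
  | 0%N => (jetN1, jet1, jet1)
  | 1%N => (jet_scale_sqr, jet_radial, jet1)
  | 2%N => (jet_scale_sqr, jet_sqr, jet1)
  | _ => (jet_scale_sqr, jet_sqr, jet_sin_sqr)
  end.

(** The upper index is [k], and 0, 1, 2, 3 stand for t, r, theta, phi. *)
Definition christoffel_jets (k i j : nat) : jet * jet * jet :=
  match k, i, j with
  | 0, 1, 1 => (jet_scaleM, jet_radial, jet1)
  | 0, 2, 2 => (jet_scaleM, jet_sqr, jet1)
  | 0, 3, 3 => (jet_scaleM, jet_sqr, jet_sin_sqr)
  | 1, 0, 1 | 1, 1, 0 | 2, 0, 2 | 2, 2, 0 | 3, 0, 3 | 3, 3, 0 =>
      (jet_hubble, jet1, jet1)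
  | 1, 1, 1 => (jet1, jet_kradial, jet1)
  | 1, 2, 2 => (jet1, jet_bend, jet1)
  | 1, 3, 3 => (jet1, jet_bend, jet_sin_sqr)
  | 2, 1, 2 | 2, 2, 1 | 3, 1, 3 | 3, 3, 1 => (jet1, jet_inv, jet1)
  | 2, 3, 3 => (jet1, jet1, jet_sincos)
  | 3, 2, 3 | 3, 3, 2 => (jet1, jet1, jet_cot)
  | _, _, _ => (jet0, jet1, jet1)
  end%N.

Definition regular (x : 'rV[R]_(1 + 3)) : Prop :=
  [/\ t0 < x 0 o0, 0 < x 0 o1, kappa * x 0 o1 ^+ 2 < 1 & 0 < x 0 o2 < pi].

Definition jets_valid (p : jet * jet * jet) (x : 'rV[R]_(1 + 3)) : Prop :=
  [/\ is_jet p.1.1 (x 0 o0), is_jet p.1.2 (x 0 o1) & is_jet p.2 (x 0 o2)].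

Lemma regular_neq0 x : regular x ->
  [/\ a (x 0 o0) != 0, x 0 o1 != 0, 1 - kappa * x 0 o1 ^+ 2 != 0
    & sin (x 0 o2) != 0].
Proof.
case=> h0 h1 h2 h3; split.
- exact: scale_factor_neq0 ha _ h0.
- by rewrite gt_eqF.
- by rewrite gt_eqF // subr_gt0.
- by rewrite gt_eqF // sin_gt0_pi.
Qed.

Section jets.
Context (x : 'rV[R]_(1 + 3)) (hx : regular x).

Let tx : t0 < x 0 o0. Proof. by case: hx. Qed.
Let an : a (x 0 o0) != 0. Proof. by case: (regular_neq0 _ hx). Qed.
Let rn : x 0 o1 != 0. Proof. by case: (regular_neq0 _ hx). Qed.
Let ln : 1 - kappa * x 0 o1 ^+ 2 != 0. Proof. by case: (regular_neq0 _ hx). Qed.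
Let sn : sin (x 0 o2) != 0. Proof. by case: (regular_neq0 _ hx). Qed.

Let da := is_derive_scale ha _ tx.
Let da1 := is_derive_scale1 ha _ tx.

Let jC (k y : R) : is_jet (fun=> k, fun=> 0) y.
Proof. exact: is_derive1C. Qed.

Let j_scale_sqr : is_jet jet_scale_sqr (x 0 o0).
Proof. exact: is_derive1_sqr. Qed.

Let j_scaleM : is_jet jet_scaleM (x 0 o0).
Proof. exact: (is_derive1M _ _ _ _ _ da da1). Qed.

Let j_hubble : is_jet jet_hubble (x 0 o0).
Proof. exact: (is_derive1M _ _ _ _ _ da1 (is_derive1V _ _ _ an da)). Qed.

Let did (y : R) : is_derive y 1 id 1. Proof. exact: is_derive_id. Qed.

Let dl (y : R) : is_derive y 1 (fun r => 1 - kappa * r ^+ 2) (0 - kappa * (2 * y * 1)).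
Proof.
exact: (is_derive1B _ _ _ _ _ (is_derive1C 1 y)
  (is_derive1Z _ kappa _ _ (is_derive1_sqr _ _ _ (did y)))).
Qed.

Let j_radial : is_jet jet_radial (x 0 o1).
Proof. exact: (is_derive1V (fun r => 1 - kappa * r ^+ 2) _ _ ln (dl _)). Qed.

Let j_sqr : is_jet jet_sqr (x 0 o1).
Proof. exact: (is_derive1_sqr _ _ _ (did _)). Qed.

Let j_kradial : is_jet jet_kradial (x 0 o1).
Proof.
exact: (is_derive1M _ _ _ _ _ (is_derive1Z _ kappa _ _ (did _)) j_radial).
Qed.

Let j_bend : is_jet jet_bend (x 0 o1).
Proof. exact: (is_derive1N _ _ _ (is_derive1M _ _ _ _ _ (did _) (dl _))). Qed.

Let j_inv : is_jet jet_inv (x 0 o1).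
Proof. exact: (is_derive1V id _ _ rn (did _)). Qed.

Let j_sin_sqr : is_jet jet_sin_sqr (x 0 o2).
Proof. exact: (is_derive1_sqr _ _ _ (is_derive_sin _)). Qed.

Let j_sincos : is_jet jet_sincos (x 0 o2).
Proof.
exact: (is_derive1N _ _ _
  (is_derive1M _ _ _ _ _ (is_derive_sin _) (is_derive_cos _))).
Qed.

Let j_cot : is_jet jet_cot (x 0 o2).
Proof.
exact: (is_derive1M _ _ _ _ _ (is_derive_cos _)
  (is_derive1V _ _ _ sn (is_derive_sin _))).
Qed.

Lemma metric_jets_valid i : jets_valid (metric_jets i) x.
Proof. by case: i => [|[|[|i]]]; split; rewrite /=;
  first [exact: jC|exact: j_scale_sqr|exact: j_scaleM|exact: j_hubble|
  exact: j_radial|exact: j_sqr|exact: j_kradial|exact: j_bend|exact: j_inv|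
  exact: j_sin_sqr|exact: j_sincos|exact: j_cot].
Qed.

Lemma christoffel_jets_valid (k i j : 'I_(1 + 3)) :
  jets_valid (christoffel_jets k i j) x.
Proof.
move: k i j; apply: ord4P; apply: ord4P; apply: ord4P;
  split; rewrite /=;
  first [exact: jC|exact: j_scale_sqr|exact: j_scaleM|exact: j_hubble|
  exact: j_radial|exact: j_sqr|exact: j_kradial|exact: j_bend|exact: j_inv|
  exact: j_sin_sqr|exact: j_sincos|exact: j_cot].
Qed.

End jets.

End flrw_connection.

(** * Derivation of the Christoffel symbols from the metric *)

Section flrw_curvature.
Context {R : realType} {kappa t0 : R} {a : R -> R}.
Hypothesis ha : scale_factor t0 a.

Local Notation a1 := (derive1 a).
Local Notation g := (flrw_metric kappa a).
Local Notation regular := (@regular R kappa t0).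
Local Notation metric_jets := (@metric_jets R kappa a).
Local Notation christoffel_jets := (@christoffel_jets R kappa a).

Definition metric_diag (i : 'I_(1 + 3)) (x : 'rV[R]_(1 + 3)) : R :=
  separated (metric_jets i) x.

Let split0 : fintype.split o0 = inl ord0 :> 'I_1 + 'I_3.
Proof. by rewrite -[RHS]unsplitK; congr fintype.split; exact: val_inj. Qed.
Let split1 : fintype.split o1 = inr 0 :> 'I_1 + 'I_3.
Proof. by rewrite -[RHS]unsplitK; congr fintype.split; exact: val_inj. Qed.
Let split2 : fintype.split o2 = inr 1 :> 'I_1 + 'I_3.
Proof. by rewrite -[RHS]unsplitK; congr fintype.split; exact: val_inj. Qed.
Let split3 : fintype.split o3 = inr 2 :> 'I_1 + 'I_3.
Proof. by rewrite -[RHS]unsplitK; congr fintype.split; exact: val_inj. Qed.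
Let shift0 : rshift 1 (0 : 'I_3) = o1. Proof. exact: val_inj. Qed.
Let shift1 : rshift 1 (1 : 'I_3) = o2. Proof. exact: val_inj. Qed.
Let ord00 : (0 : 'I_(1 + 3)) = o0. Proof. exact: val_inj. Qed.

Lemma flrw_metric_diag x : g x = diag_mx (\row_i metric_diag i x).
Proof.
apply/matrixP => i j; rewrite [RHS]mxE mxE /metric_diag /separated.
move: i j; apply: ord4P; apply: ord4P; rewrite /flrw_metric !mxE;
  rewrite ?split0 ?split1 ?split2 ?split3 !mxE;
  rewrite ?split0 ?split1 ?split2 ?split3 !mxE /= ?mulr1n ?mulr0n
    ?shift0 ?shift1 ?ord00 ?mulr0 ?mulr1 // ?mulrA //.
Qed.

Lemma flrw_metricE x i j : g x i j = metric_diag i x *+ (i == j).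
Proof. by rewrite flrw_metric_diag !mxE. Qed.

Lemma metric_diag_neq0 i x : regular x -> metric_diag i x != 0.
Proof.
move=> hx; have [an rn ln sn] := regular_neq0 ha _ hx.
rewrite /metric_diag /separated; move: i; apply: ord4P;
  rewrite /= ?mulr1 ?oppr_eq0 ?oner_eq0 // !mulf_neq0 ?expf_neq0 //.
by rewrite invr_eq0.
Qed.

Lemma invmx_flrw_metric x : regular x ->
  invmx (g x) = diag_mx (\row_i (metric_diag i x)^-1).
Proof.
move=> hx; have e : diag_mx (\row_i (metric_diag i x)^-1) *m g x = 1%:M.
  rewrite flrw_metric_diag mulmx_diag; apply/matrixP => i j; rewrite !mxE.
  by rewrite mulVf // metric_diag_neq0.
have u : g x \in unitmx by case: (mulmx1_unit e).
by rewrite -[LHS]mul1mx -e -mulmxA mulmxV // mulmx1.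
Qed.

Lemma partial_flrw_metric m j l x : regular x ->
  partial m (fun y => g y j l) x
  = separated_partial m (metric_jets j) x *+ (j == l).
Proof.
move=> hx; case: (eqVneq j l) => [<-|jl].
  rewrite (_ : (fun y => g y j j) = separated (metric_jets j)).
    by have [? ? ?] := metric_jets_valid ha _ hx j; rewrite partial_separated.
  by apply/funext => y; rewrite flrw_metricE eqxx.
rewrite (_ : (fun y => g y j l) = (fun=> 0)).
  by rewrite /partial mulr0n derive_cst.
by apply/funext => y; rewrite flrw_metricE (negbTE jl).
Qed.

(** The inverse metric is diagonal, so only [l = k] contributes to the sum; the 64 index
    combinations are then rational identities. *)
Lemma flrw_christoffelE k i j x : regular x ->
  christoffel g k i j x = separated (christoffel_jets k i j) x.
Proof.
move=> hx; rewrite /christoffel invmx_flrw_metric //.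
rewrite (bigD1 k) //= big1 ?addr0 => [|l lk]; last first.
  by rewrite !mxE eq_sym (negbTE lk) mulr0n mul0r.
rewrite !mxE eqxx mulr1n !partial_flrw_metric //.
have [an rn ln sn] := regular_neq0 ha _ hx.
rewrite /metric_diag /separated.
move: k i j; apply: ord4P; apply: ord4P; apply: ord4P;
  rewrite /= ?mulr1n ?mulr0n; field; rewrite ?an ?rn ?ln ?sn //.
Qed.

End flrw_curvature.

(** * The Riemann tensor and the tidal operator *)

Section flrw_riemann.
Context {R : realType} {kappa t0 : R} {a : R -> R}.
Hypothesis ha : scale_factor t0 a.

Local Notation a1 := (derive1 a).
Local Notation g := (flrw_metric kappa a).
Local Notation regular := (@regular R kappa t0).
Local Notation christoffel_jets := (@christoffel_jets R kappa a).
Local Notation metric_diag := (@metric_diag R kappa a).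

(** Openness of regularity allows formulas valid at regular points to be differentiated there. *)
Lemma regular_near x : regular x -> \forall y \near x, regular y.
Proof.
case=> h0 h1 h2 /andP[h3 h4].
have cc i : {for x, continuous (fun y : 'rV[R]_(1 + 3) => y 0 i)}.
  exact: coord_continuous.
have ck : {for x, continuous (fun y : 'rV[R]_(1 + 3) => kappa * y 0 o1 ^+ 2)}.
  apply: continuousM; first exact: cst_continuous.
  exact: (continuousM (cc o1) (cc o1)).
near=> y; split.
- by near: y; exact: (cvgr_gt _ (cc o0)).
- by near: y; exact: (cvgr_gt _ (cc o1)).
- by near: y; exact: (cvgr_lt _ ck).
- apply/andP; split; near: y; first exact: (cvgr_gt _ (cc o2)).
  exact: (cvgr_lt _ (cc o2)).
Unshelve. all: by end_near. Qed.

Lemma partial_christoffel m k i j x : regular x ->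
  partial m (christoffel g k i j) x
  = separated_partial m (christoffel_jets k i j) x.
Proof.
move=> hx; have [? ? ?] := christoffel_jets_valid ha _ hx k i j.
rewrite -partial_separated // /partial.
have h : \near x, christoffel g k i j x = separated (christoffel_jets k i j) x.
  by apply: filterS (regular_near _ hx) => y; exact: (flrw_christoffelE ha).
exact: (near_eq_derive _ h).
Qed.

(** The spacetime sectional curvature of planes tangent to the slices of constant t. Planes
    containing d/dt have a''/a instead, and [hubble_term] is the difference of the two. *)
Definition spatial_curvature (t : R) : R := (a1 t ^+ 2 + kappa) / a t ^+ 2.

(** A tensor of constant curvature [spatial_curvature], corrected in the planes containing d/dt.
    Only the metric and the time direction enter, as isotropy of the slices suggests. *)
Definition riemann_form (l k i j : 'I_(1 + 3)) (x : 'rV[R]_(1 + 3)) : R :=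
  spatial_curvature (x 0 o0) *
    (metric_diag j x * (j == k)%:R * (l == i)%:R
     - metric_diag i x * (i == k)%:R * (l == j)%:R)
  - hubble_term kappa a (x 0 o0) *
    ((j == o0)%:R * (k == o0)%:R * (l == i)%:R
     - (i == o0)%:R * (k == o0)%:R * (l == j)%:R
     - metric_diag j x * (j == k)%:R * ((i == o0)%:R * (l == o0)%:R)
     + metric_diag i x * (i == k)%:R * ((j == o0)%:R * (l == o0)%:R)).

Lemma riemann_antisym l k i j x : riemann g l k i j x = - riemann g l k j i x.
Proof.
rewrite /riemann opprD opprB; congr (_ + _).
by rewrite -sumrN; apply: eq_bigr => m _; rewrite opprB.
Qed.

Lemma riemann_form_antisym l k i j x :
  riemann_form l k i j x = - riemann_form l k j i x.
Proof. by rewrite /riemann_form; ring. Qed.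

(** The restriction to [i < j] leaves 96 of the 256 index combinations to be computed; antisymmetry
    supplies the others. *)
Lemma flrw_riemannE_lt l k (i j : 'I_(1 + 3)) x : regular x -> (i < j)%N ->
  riemann g l k i j x = riemann_form l k i j x.
Proof.
move=> hx; have [an rn ln sn] := regular_neq0 ha _ hx.
rewrite /riemann_form /riemann !partial_christoffel // sum_ord4 !(flrw_christoffelE ha _ _ _ _ hx).
rewrite /spatial_curvature /hubble_term /metric_diag /separated /separated_partial.
move: (x 0 o0) (x 0 o1) (x 0 o2) an rn ln sn => t r u an rn ln sn.
move: l k i j; apply: ord4P; apply: ord4P; apply: ord4P; apply: ord4P.
all: move=> //= _.
(* The functions become independent variables, and each case is a rational identity in them. *)
all: move: (derive1 (derive1 a) t) (derive1 a t) (a t) (sin u) (cos u) an rn ln sn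
  => A2 A1 A s c an rn ln sn.
all: by field; rewrite ?an ?rn ?ln ?sn.
Qed.

Lemma flrw_riemannE l k i j x : regular x ->
  riemann g l k i j x = riemann_form l k i j x.
Proof.
move=> hx; case: (ltngtP i j) => [ij|ji|/val_inj <-].
- exact: flrw_riemannE_lt.
- by rewrite riemann_antisym riemann_form_antisym flrw_riemannE_lt.
- have h (z : R) : z = - z -> z = 0 by move=> ?; lra.
  by rewrite (h _ (riemann_antisym _ _ _ _ _)) (h _ (riemann_form_antisym _ _ _ _ _)).
Qed.

Lemma flrw_metric_at x (v w : 'rV[R]_(1 + 3)) :
  metric_at (g x) v w = \sum_(i < 1 + 3) metric_diag i x * v 0 i * w 0 i.
Proof.
rewrite /metric_at mxE; apply: eq_bigr => i _.
rewrite mxE (bigD1 i) //= big1 => [|m mi]; last first.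
  by rewrite flrw_metricE (negbTE mi) mulr0n mulr0.
by rewrite flrw_metricE eqxx mulr1n mxE addr0 (mulrC (v 0 i)).
Qed.

(** Contraction of [riemann_form] leaves only scalar products and time components, so the spherical
    coordinates disappear from the Jacobi equation. *)
Lemma flrw_tidalE x (J u : 'rV[R]_(1 + 3)) l : regular x ->
  let guu := metric_at (g x) u u in
  let gJu := metric_at (g x) J u in
  curvature g x J u u 0 l =
  spatial_curvature (x 0 o0) * (guu * J 0 l - gJu * u 0 l)
  - hubble_term kappa a (x 0 o0) *
    (u 0 o0 ^+ 2 * J 0 l - J 0 o0 * u 0 o0 * u 0 l
     + (gJu * u 0 o0 - guu * J 0 o0) * (l == o0)%:R).
Proof.
move=> hx /=.
rewrite !flrw_metric_at /curvature mxE.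
under eq_bigr do under eq_bigr do under eq_bigr do rewrite (flrw_riemannE _ _ _ _ _ hx).
rewrite /riemann_form.
move: (spatial_curvature _) (hubble_term _ _ _) => K h.
rewrite !sum_ord4.
move: (metric_diag o0 x) (metric_diag o1 x) (metric_diag o2 x) (metric_diag o3 x).
by move: l; apply: ord4P => g0 g1 g2 g3; rewrite /=; ring.
Qed.

End flrw_riemann.

(** * Geodesics and Jacobi tensors *)

Section along_geodesic.
Context {R : realType} {kappa t0 : R} {a : R -> R}.
Hypothesis ha : scale_factor t0 a.
Context {M : space_form kappa} {gam : curve R M} {eps C : R}.
Hypothesis heps : eps = -1 \/ eps = 0.
Hypothesis C_gt0 : 0 < C.
Hypothesis hgam : is_geodesic a gam t0 eps C.

Local Notation a1 := (derive1 a).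
Local Notation g := (flrw_metric kappa a).
Local Notation regular := (@regular R kappa t0).
Local Notation christoffel_jets := (@christoffel_jets R kappa a).
Local Notation metric_jets := (@metric_jets R kappa a).
Local Notation metric_diag := (@metric_diag R kappa a).
Local Notation T := (ctime gam).
Local Notation D := (cdom gam).
Local Notation on_chart := (on_chart gam).
Local Notation cpos := (cpos gam).
Local Notation vel := (velocity gam).
Local Notation gdot := (gdot a gam).
Local Notation covD := (covD a gam).
Local Notation speed := (@speed R a eps C).
Implicit Types (c : chart M) (V W : field (M := M)) (s : R).

Lemma exists_on_chart s : D s -> exists c, on_chart c s.
Proof. by move=> Ds; have [c hc] := chart_cover (cspace gam s); exists c. Qed.

Lemma cpos_time c s : cpos c s 0 o0 = T s.
Proof.
rewrite (_ : o0 = lshift 3 ord0); last exact: val_inj.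
by rewrite row_mxEl mxE mulr1n.
Qed.

Lemma cpos_space c s (i : 'I_3) : cpos c s 0 (rshift 1 i) = Defs.coord c (cspace gam s) 0 i.
Proof. by rewrite row_mxEr. Qed.

Lemma cpos_regular c s : on_chart c s -> regular (cpos c s).
Proof.
case=> Ds /chart_spherical [h1 h2 h3]; have [[_ hT _ _] _] := hgam.
rewrite /regular cpos_time.
rewrite (_ : o1 = rshift 1 (0 : 'I_3)); last exact: val_inj.
rewrite (_ : o2 = rshift 1 (1 : 'I_3)); last exact: val_inj.
by rewrite !cpos_space; split => //; exact: hT.
Qed.

(** Chart domains and [cdom] are open and the curve is continuous, so derivatives at [s] may be
    computed in a single chart. *)
Lemma near_on_chart c s : on_chart c s -> \forall u \near s, on_chart c u.
Proof.
move=> [Ds hc]; have [[[oD _] _ _ cS] _] := hgam.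
have h1 : \forall u \near s, D u by exact: (open_nbhs_nbhs (conj oD Ds)).
have h2 : \forall u \near s, chart_dom c (cspace gam u).
  apply: (cS s Ds).
  exact: (open_nbhs_nbhs (conj (chart_dom_open c) hc)).
by near=> u; split; near: u.
Unshelve. all: by end_near. Qed.

Lemma is_derive_cpos c s mu : on_chart c s ->
  is_derive s 1 (fun u => cpos c u 0 mu) (vel c s 0 mu).
Proof.
move=> hc; have [_ [[dp _ _] _]] := hgam.
by rewrite mxE; apply: derivable_is_derive1; exact: dp.
Qed.

Lemma is_derive_separated p c s : on_chart c s -> jets_valid p (cpos c s) ->
  is_derive s 1 (fun u => separated p (cpos c u))
    (\sum_(m < 1 + 3) separated_partial m p (cpos c s) * vel c s 0 m).
Proof.
move=> hc [h0 h1 h2].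
have ch (j : @jet R) i : is_jet j (cpos c s 0 i) ->
    is_derive s 1 (fun u => j.1 (cpos c u 0 i)) (j.2 (cpos c s 0 i) * vel c s 0 i).
  by move=> hj; exact: (is_derive1_chain j.1 _ _ _ _ hj (is_derive_cpos _ _ i hc)).
have := is_derive1M _ _ _ _ _ (is_derive1M _ _ _ _ _ (ch _ _ h0) (ch _ _ h1)) (ch _ _ h2).
by move/is_derive_eq; apply; rewrite sum_ord4 /=; ring.
Qed.

Definition covD_correction V c s (mu : 'I_(1 + 3)) : R :=
  \sum_(nu < 1 + 3) \sum_(la < 1 + 3)
    separated (christoffel_jets mu nu la) (cpos c s) * vel c s 0 nu * V c s 0 la.

Lemma is_derive_field V c s mu : derivable_field gam V -> on_chart c s ->
  is_derive s 1 (fun u => V c u 0 mu)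
    (covD V c s 0 mu - covD_correction V c s mu).
Proof.
move=> dV hc; have := derivable_is_derive1 _ _ (dV c s mu hc).
move/is_derive_eq; apply; rewrite mxE.
rewrite [X in _ = _ + X - _](_ : _ = covD_correction V c s mu).
  by rewrite addrK.
apply: eq_bigr => nu _; apply: eq_bigr => la _.
by rewrite (flrw_christoffelE ha) //; exact: cpos_regular.
Qed.

Lemma gdotE V W c s :
  gdot V W c s = \sum_(i < 1 + 3) metric_diag i (cpos c s) * V c s 0 i * W c s 0 i.
Proof. exact: flrw_metric_at. Qed.

(** Compatibility of the connection with the metric, checked in coordinates: the derivatives of the
    metric coefficients cancel the Christoffel terms of the two fields. *)
Lemma is_derive_gdot V W c s : derivable_field gam V -> derivable_field gam W ->
  on_chart c s ->
  is_derive s 1 (gdot V W c) (gdot (covD V) W c s + gdot V (covD W) c s).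
Proof.
move=> dV dW hc; have hx := cpos_regular _ _ hc.
have -> : gdot V W c = (fun u => \sum_(i < 1 + 3)
    metric_diag i (cpos c u) * V c u 0 i * W c u 0 i).
  by apply/funext => u; exact: gdotE.
have := is_derive1_sum _ _ _ _ (fun i => is_derive1M _ _ _ _ _ (is_derive1M _ _ _ _ _
  (is_derive_separated (metric_jets i) c s hc (metric_jets_valid ha _ hx i))
  (is_derive_field V c s i dV hc)) (is_derive_field W c s i dW hc)).
move/is_derive_eq; apply; rewrite !gdotE /covD_correction.
have [an rn ln sn] := regular_neq0 ha _ hx.
rewrite !sum_ord4 /metric_diag /separated /separated_partial /=.
move: (covD V c s) (covD W c s) (V c s) (W c s) (vel c s) => dv dw v w u.
move: (cpos c s) an rn ln sn {hx} => x.
move: (derive1 a (x 0 o0)) (a (x 0 o0)) (x 0 o1) (sin (x 0 o2)) (cos (x 0 o2)).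
move=> A1 A r si co an rn ln sn.
move: (dv 0 o0) (dv 0 o1) (dv 0 o2) (dv 0 o3) => dv0 dv1 dv2 dv3.
move: (dw 0 o0) (dw 0 o1) (dw 0 o2) (dw 0 o3) => dw0 dw1 dw2 dw3.
move: (v 0 o0) (v 0 o1) (v 0 o2) (v 0 o3) => v0 v1 v2 v3.
move: (w 0 o0) (w 0 o1) (w 0 o2) (w 0 o3) => w0 w1 w2 w3.
move: (u 0 o0) (u 0 o1) (u 0 o2) (u 0 o3) => u0 u1 u2 u3.
by field; rewrite an rn ln sn.
Qed.

Lemma gdot_velocity c s : on_chart c s -> gdot vel vel c s = eps.
Proof. by have [_ [_ [_ h _]]] := hgam; exact: h. Qed.

(** The normalizations by [eps] and [C] determine the square of the time component; positivity of T'
    selects the root. *)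
Lemma velocity_time c s : on_chart c s ->
  vel c s 0 o0 = speed (T s) / a (T s).
Proof.
move=> hc; have [[_ hT _ _] [_ [u_gt0 _ hC]]] := hgam.
have Ds : D s by case: hc.
have a0 : 0 < a (T s) by apply: (scale_factor_gt0 ha); exact: hT.
have an : a (T s) != 0 by rewrite gt_eqF.
have u0 : 0 < vel c s 0 o0.
  have -> : vel c s 0 o0 = derive1 T s; last exact: u_gt0.
  by rewrite mxE; congr (derive1 _ s); apply/funext => u; exact: cpos_time.
have := gdot_velocity _ _ hc; rewrite gdotE sum_ord4 => e1.
have := hC _ _ hc; rewrite !big_ord_recl !big_ord0 !flrw_metricE /= !mulr1n !mulr0n.
rewrite !(mul0r, addr0, add0r).
rewrite (_ : rshift 1 ord0 = o1); last exact: val_inj.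
rewrite (_ : rshift 1 (lift ord0 ord0) = o2); last exact: val_inj.
rewrite (_ : rshift 1 (lift ord0 (lift ord0 ord0)) = o3); last exact: val_inj.
move=> e2.
have m0 : metric_diag o0 (cpos c s) = -1.
  by rewrite /metric_diag /separated /= !mulr1.
rewrite m0 in e1.
have sq : vel c s 0 o0 ^+ 2 = (speed (T s) / a (T s)) ^+ 2.
  rewrite expr_div_n (speed_sqr heps C_gt0) -e1 -e2.
  by field.
apply/eqP; rewrite -(@eqrXn2 _ 2) ?sq ?(ltW u0) //.
by rewrite divr_ge0 ?ltW // (speed_gt0 heps C_gt0).
Qed.

Lemma is_derive_time s : D s -> is_derive s 1 T (speed (T s) / a (T s)).
Proof.
move=> Ds; have [c hc] := exists_on_chart _ Ds.
have := is_derive_cpos _ _ o0 hc; rewrite (velocity_time _ _ hc).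
by under eq_fun do rewrite cpos_time.
Qed.

Lemma velocity_time_sqr c s : on_chart c s ->
  vel c s 0 o0 ^+ 2 = C / a (T s) ^+ 2 - eps.
Proof.
move=> hc; have [[_ hT _ _] _] := hgam.
rewrite (velocity_time _ _ hc) expr_div_n (speed_sqr heps C_gt0).
by field; apply: (scale_factor_neq0 ha); apply: hT; case: hc.
Qed.

Lemma tidalE (J : field (M := M)) c s l : on_chart c s ->
  tidal a gam J c s 0 l =
  spatial_curvature (kappa := kappa) (a := a) (T s) *
    (eps * J c s 0 l - gdot J vel c s * vel c s 0 l)
  - hubble_term kappa a (T s) *
    ((C / a (T s) ^+ 2 - eps) * J c s 0 l - J c s 0 o0 * vel c s 0 o0 * vel c s 0 l
     + (gdot J vel c s * vel c s 0 o0 - eps * J c s 0 o0) * (l == o0)%:R).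
Proof.
move=> hc; rewrite /tidal (flrw_tidalE ha) /=; last exact: cpos_regular.
rewrite -/(gdot vel vel c s) -/(gdot J vel c s) gdot_velocity //.
by rewrite velocity_time_sqr // cpos_time.
Qed.

(* Gamma^0_ij = (a'/a) g_ij gives p' = -(a'/a) t' p for the time component p
   of E. *)
Lemma parallel_time_component (E : field (M := M)) c s :
  derivable_field gam E -> on_chart c s -> covD E c s = 0 ->
  gdot E vel c s = 0 ->
  is_derive s 1 (fun u => a (T u) * E c u 0 o0) 0.
Proof.
move=> dE hc DE Eu; have [[_ hT _ _] _] := hgam.
have tt : t0 < T s by apply: hT; case: hc.
have an := scale_factor_neq0 ha _ tt.
have dT : is_derive s 1 T (vel c s 0 o0).
  by rewrite (velocity_time _ _ hc); apply: is_derive_time; case: hc.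
have := is_derive1M _ _ _ _ _ (is_derive1_chain a T _ _ _ (is_derive_scale ha _ tt) dT)
  (is_derive_field E c s o0 dE hc).
move/is_derive_eq; apply.
have -> : covD E c s 0 o0 = 0 by rewrite DE mxE.
rewrite sub0r.
move: Eu; rewrite gdotE /covD_correction !sum_ord4 /metric_diag /separated /=.
rewrite cpos_time => Eu.
(* The whole expression is -a' times the scalar product of [E] with the velocity, which is zero by
   [Eu]. *)
transitivity (- (derive1 a (T s) *
  (- E c s 0 o0 * vel c s 0 o0 +
   a (T s) ^+ 2 / (1 - kappa * cpos c s 0 o1 ^+ 2) * 1 * E c s 0 o1 * vel c s 0 o1 +
   a (T s) ^+ 2 * cpos c s 0 o1 ^+ 2 * 1 * E c s 0 o2 * vel c s 0 o2 +
   a (T s) ^+ 2 * cpos c s 0 o1 ^+ 2 * sin (cpos c s 0 o2) ^+ 2 *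
     E c s 0 o3 * vel c s 0 o3))).
  by move: (derive1 a (T s)) (1 - kappa * _)^-1 => A1 L; ring.
by rewrite -[RHS](mulr0 (- derive1 a (T s))) -Eu; ring.
Qed.

End along_geodesic.

(** * Determinants of size 2 and 3, and their limits *)

Lemma det_mx22E {R : comNzRingType} (A : 'M[R]_2) :
  let f i j := A (inord i) (inord j) in
  \det A = f 0%N 0%N * f 1%N 1%N - f 0%N 1%N * f 1%N 0%N.
Proof.
(* Indexing by natural numbers lets the lifted ordinals of the cofactor expansion reduce to
   numerals, so that equal entries become syntactically equal. *)
move=> f; have Af i j : A i j = f i j by rewrite /f !inord_val.
rewrite (expand_det_row _ 0) !big_ord_recl big_ord0 /cofactor !det_mx11.
by rewrite !mxE !Af /= /bump /=; ring.
Qed.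

Lemma det_mx33E {R : comNzRingType} (A : 'M[R]_3) :
  let f i j := A (inord i) (inord j) in
  \det A = f 0%N 0%N * (f 1%N 1%N * f 2%N 2%N - f 1%N 2%N * f 2%N 1%N)
         - f 0%N 1%N * (f 1%N 0%N * f 2%N 2%N - f 1%N 2%N * f 2%N 0%N)
         + f 0%N 2%N * (f 1%N 0%N * f 2%N 1%N - f 1%N 1%N * f 2%N 0%N).
Proof.
move=> f; have Af i j : A i j = f i j by rewrite /f !inord_val.
rewrite (expand_det_row _ 0) !big_ord_recl big_ord0 /cofactor.
rewrite !(expand_det_row _ 0) !big_ord_recl !big_ord0 /cofactor !det_mx11.
by rewrite !mxE !Af /= /bump /=; ring.
Qed.

Section vanishing_determinants.
Context {R : realType} {F : set_system R} {FF : Filter F}.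

Lemma cvg0_mul_bounded (f g : R -> R) :
  (exists M : R, \forall t \near F, `|f t| <= M) -> g t @[t --> F] --> 0 ->
  f t * g t @[t --> F] --> 0.
Proof.
move=> [M hM] g0; apply/norm_cvg0P.
have Mg : M * `|g t| @[t --> F] --> 0.
  by rewrite -[X in _ --> X](mulr0 M); apply: cvgMr; apply/norm_cvg0P.
apply: (@squeeze_cvgr _ _ _ _ (fun=> 0) (fun t => M * `|g t|)) => //; last exact: cvg_cst.
by apply: filterS hM => t ht; rewrite normr_ge0 normrM ler_wpM2r.
Qed.

Let cvg0M (f g : R -> R) : f t @[t --> F] --> 0 -> g t @[t --> F] --> 0 ->
  f t * g t @[t --> F] --> 0.
Proof. by move=> f0 g0; rewrite -[X in _ --> X](mulr0 0); apply: cvgM. Qed.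

Let cvg0B (f g : R -> R) : f t @[t --> F] --> 0 -> g t @[t --> F] --> 0 ->
  f t - g t @[t --> F] --> 0.
Proof. by move=> f0 g0; rewrite -[X in _ --> X](subr0 0); apply: cvgB. Qed.

Let cvg0D (f g : R -> R) : f t @[t --> F] --> 0 -> g t @[t --> F] --> 0 ->
  f t + g t @[t --> F] --> 0.
Proof. by move=> f0 g0; rewrite -[X in _ --> X](addr0 0); apply: cvgD. Qed.

Let cvg0Z (k : R) (f : R -> R) : f t @[t --> F] --> 0 ->
  k * f t @[t --> F] --> 0.
Proof. by move=> f0; rewrite -[X in _ --> X](mulr0 k); apply: cvgMr. Qed.

Lemma det2_cvg0 (A : R -> 'M[R]_2) :
  (forall i j, A t i j @[t --> F] --> 0) -> \det (A t) @[t --> F] --> 0.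
Proof.
move=> A0; under eq_fun do rewrite det_mx22E.
by apply: cvg0B; apply: cvg0M.
Qed.

(* Only terms of order at least 2 in b survive in det (p y^T + b). *)
Lemma det3_rank1_cvg0 (A : R -> 'M[R]_3) (p : 'I_3 -> R)
    (y : 'I_3 -> R -> R) (b : 'I_3 -> 'I_3 -> R -> R) :
  (forall t i j, A t i j = p i * y j t + b i j t) ->
  (forall j, exists M : R, \forall t \near F, `|y j t| <= M) ->
  (forall i j, b i j t @[t --> F] --> 0) ->
  \det (A t) @[t --> F] --> 0.
Proof.
move=> AE yb b0.
pose bb i j t := b (inord i) (inord j) t.
pose pp i := p (inord i).
pose minor i i' j j' t := bb i j t * bb i' j' t - bb i j' t * bb i' j t.
(* [cof j j'] is the determinant with columns [p], b_j and b_j'. By multilinearity in the columns,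
   the terms with two columns along [p] drop out, which gives the expansion used below. *)
pose cof j j' t := pp 0%N * minor 1%N 2%N j j' t
  - pp 1%N * minor 0%N 2%N j j' t + pp 2%N * minor 0%N 1%N j j' t.
have minor0 i i' j j' : minor i i' j j' t @[t --> F] --> 0.
  by apply: cvg0B; apply: cvg0M; exact: b0.
have cof0 j j' : cof j j' t @[t --> F] --> 0.
  by apply: cvg0D; [apply: cvg0B|]; apply: cvg0Z.
have -> : (fun t => \det (A t)) = (fun t =>
    y (inord 0) t * cof 1%N 2%N t - y (inord 1) t * cof 0%N 2%N t
    + y (inord 2) t * cof 0%N 1%N t
    + (bb 0%N 0%N t * minor 1%N 2%N 1%N 2%N t
       - bb 0%N 1%N t * minor 1%N 2%N 0%N 2%N t
       + bb 0%N 2%N t * minor 1%N 2%N 0%N 1%N t)).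
  apply/funext => t; rewrite det_mx33E /= !AE /cof /minor /bb /pp.
  by ring.
apply: cvg0D.
  by apply: cvg0D; [apply: cvg0B|]; apply: cvg0_mul_bounded.
by apply: cvg0D; [apply: cvg0B|]; apply: cvg0M => //; exact: b0.
Qed.

End vanishing_determinants.

(** * The Jacobi tensor in a parallel frame *)

Section focusing.
Context {R : realType} {kappa t0 : R} {a : R -> R}.
Hypothesis ha : scale_factor t0 a.
Context {M : space_form kappa} {gam : curve R M} {tau : R -> R} {eps C t1 s2 : R}.
Hypothesis heps : eps = -1 \/ eps = 0.
Hypothesis C_gt0 : 0 < C.
Hypothesis hgam : is_geodesic a gam t0 eps C.
Hypothesis htau : forall s, cdom gam s -> tau (ctime gam s) = s.
Hypothesis ht1 : t0 < t1.
Hypothesis hint : (\int[lebesgue_measure]_(t' in `[t, t1])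
               (a t' * \int[lebesgue_measure]_(t'' in `[t', t1])
                         ((a t'')^-1 * hubble_term kappa a t''))
            ) @[t --> t0^'+] --> -oo.
Hypothesis Ds2 : cdom gam s2.

Local Notation T := (ctime gam).
Local Notation D := (cdom gam).
Local Notation on_chart := (on_chart gam).
Local Notation vel := (velocity gam).
Local Notation gdot := (gdot a gam).
Local Notation covD := (covD a gam).
Local Notation hub := (hubble_term kappa a).
Local Notation q := (@transverse_coef R kappa a eps C).
Implicit Types (c : chart M) (V W : field (M := M)) (s : R).

Let T_gt s : D s -> t0 < T s. Proof. by have [[_ h _ _] _] := hgam; exact: h. Qed.

Let iD : is_interval D. Proof. by have [[[_ h] _ _ _] _] := hgam. Qed.

Let oD : open D. Proof. by have [[[h _] _ _ _] _] := hgam. Qed.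

Let T_onto t : t0 < t <= T s2 -> (T @` D) t.
Proof. by have [[_ _ h _] _] := hgam; apply: h. Qed.

Let transverse_cvg0 (B B1 : R -> R) :
  (forall s, D s -> is_derive s 1 B (B1 s)) ->
  (forall s, D s -> is_derive s 1 B1 (q (T s) * B s)) ->
  B s2 = 0 -> B (tau t) @[t --> t0^'+] --> 0.
Proof.
apply: (transverse_jacobi_cvg0 ha ht1 hint heps C_gt0 iD Ds2 T_gt T_onto htau).
exact: (is_derive_time ha heps C_gt0 hgam).
Qed.

Let metric_at_sum n (G : 'M[R]_(1 + 3)) (x : 'I_n -> R) (v : 'I_n -> 'rV[R]_(1 + 3)) w :
  metric_at G (\sum_(k < n) x k *: v k) w = \sum_(k < n) x k * metric_at G (v k) w.
Proof.
rewrite /metric_at !mulmx_suml summxE; apply: eq_bigr => k _.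
by rewrite -!scalemxAl mxE.
Qed.

Let metric_atD (G : 'M[R]_(1 + 3)) v v' w :
  metric_at G (v + v') w = metric_at G v w + metric_at G v' w.
Proof. by rewrite /metric_at !mulmxDl mxE. Qed.

Let metric_atZ (G : 'M[R]_(1 + 3)) x v w :
  metric_at G (x *: v) w = x * metric_at G v w.
Proof. by rewrite /metric_at -!scalemxAl mxE. Qed.

Let metric_diag_time x : metric_diag (kappa := kappa) (a := a) o0 x = -1.
Proof. by rewrite /metric_diag /separated /= !mulr1. Qed.

Let sum_ord3 (F : 'I_(1 + 3) -> R) :
  \sum_(k < 3) F (rshift 1 k) = F o1 + F o2 + F o3.
Proof.
rewrite !big_ord_recr big_ord0 /= add0r; congr (F _ + F _ + F _); exact: val_inj.
Qed.

Let mul_sandwich_entry (X G : 'M[R]_(1 + 3)) i j :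
  (X *m G *m X^T) i j = metric_at G (row i X) (row j X).
Proof.
rewrite /metric_at !mxE; apply: eq_bigr => m _; rewrite !mxE; congr (_ * _).
by apply: eq_bigr => n _; rewrite !mxE.
Qed.

(** For eps = 0 and J orthogonal to gamma', the tidal operator is a scalar modulo gamma', so each
    entry of [A] separately solves the transverse equation. *)
Lemma null_jacobi_entry_cvg0 (A : R -> 'M[R]_2) : eps = 0 ->
  null_jacobi_tensor a gam s2 A ->
  forall k l, A (tau t) k l @[t --> t0^'+] --> 0.
Proof.
move=> eps0 [E [[fE Eu _ E_free] dA [A0 _] jac]] k l.
apply: (transverse_cvg0 (fun s => A s k l) (derive1 (fun u => A u k l))).
- by move=> s Ds; apply: derivable_is_derive1; case: (dA s k l Ds).
- move=> s Ds; have [_ d2] := dA s k l Ds.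
  have := derivable_is_derive1 _ _ d2; move/is_derive_eq; apply.
  have [c hc] := exists_on_chart s Ds.
  have an := scale_factor_neq0 ha _ (T_gt _ Ds).
  pose J : field (M := M) := fun d u => \sum_(k < 2) A u k l *: E k d u.
  have Ju : gdot J vel c s = 0.
    rewrite /Defs.gdot metric_at_sum big1 // => i _.
    by rewrite -/(gdot (E i) vel c s) Eu // mulr0.
  have [b hb] := jac l c s hc.
  (* The defects of the transverse equation in the column [l]: their combination of frame vectors is
     a multiple of gamma', so independence of the frame modulo gamma' makes them vanish. *)
  pose x i := derive1n 2 (fun u => A u i l) s - hub (T s) * (C / a (T s) ^+ 2) * A s i l.
  suff -> : derive1 (derive1 (fun u => A u k l)) s
      = hub (T s) * (C / a (T s) ^+ 2) * A s k l.
    by rewrite /transverse_coef eps0; ring.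
  apply/eqP; rewrite -subr_eq0; apply/eqP; apply: (E_free c s x hc).
  (* The multiple of gamma' in the Jacobi equation, corrected by the one that the tidal formula
     contributes. *)
  exists (b - hub (T s) * (J c s 0 o0 * vel c s 0 o0)).
  have addE (u v : 'rV[R]_(1 + 3)) m : (u + v) 0 m = u 0 m + v 0 m by rewrite mxE.
  have scaleE (r : R) (v : 'rV[R]_(1 + 3)) m : (r *: v) 0 m = r * v 0 m by rewrite mxE.
  apply/rowP => m; have := congr1 (fun v : 'rV[R]_(1 + 3) => v 0 m) hb.
  have -> : \sum_(i < 2) x i *: E i c s
      = \sum_(i < 2) derive1n 2 (fun u => A u i l) s *: E i c s
        - (hub (T s) * (C / a (T s) ^+ 2)) *: J c s.
    rewrite /J scaler_sumr -sumrB; apply: eq_bigr => i _.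
    by rewrite /x scalerBl scalerA.
  move: (\sum_(i < 2) _ *: _) => S1.
  rewrite -scaleNr !subr0 !addE !scaleE -/J (tidalE ha heps C_gt0 hgam) // Ju eps0.
  by move=> e; rewrite [RHS]mulrBl -e; ring.
- by rewrite A0 mxE.
Qed.

(** * The timelike Jacobi tensor *)

Section timelike.
Hypothesis eps1 : eps = -1.
Context (A : R -> 'M[R]_3) (E : 'I_(1 + 3) -> field (M := M))
  (J : 'I_3 -> field (M := M)).
Hypothesis hE : parallel_orthonormal_frame a gam E.
Hypothesis jacJ : forall l, jacobi_field a gam (J l).
Hypothesis J0 : forall l c, on_chart c s2 ->
  J l c s2 = 0 /\ covD (J l) c s2 = E (rshift 1 l) c s2.
Hypothesis JE : forall l c s, on_chart c s ->
  eq_mod_velocity gam c s (J l c s) (\sum_(k < 3) A s k l *: E (rshift 1 k) c s).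

Let Es (k : 'I_3) : field (M := M) := E (rshift 1 k).

Let E_vel c s : on_chart c s -> E 0 c s = vel c s. Proof. by case: hE => _ + _ _; apply. Qed.

Let dE i : derivable_field gam (E i).
Proof. by case: hE => h _ _ _; case: (h i). Qed.

Let DE i c s : on_chart c s -> covD (E i) c s = 0.
Proof. by case: hE => _ _ + _; apply. Qed.

Let EE i j c s : on_chart c s -> gdot (E i) (E j) c s =
  if i == j then (if i == 0 then -1 else 1) else 0.
Proof. by case: hE => _ _ _; apply. Qed.

Let gdot_vel V c s : on_chart c s -> gdot V vel c s = gdot V (E 0) c s.
Proof. by move=> hc; rewrite /Defs.gdot E_vel. Qed.

(** A change of chart acts on the spatial block alone, so time components do not depend on the
    chart. *)
Let E_time i c d s : on_chart c s -> on_chart d s -> E i d s 0 o0 = E i c s 0 o0.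
Proof.
move=> hc hd; case: hE => h _ _ _; have [fE _] := h i.
rewrite (fE c d s hc hd) -[E i c s]hsubmxK mul_row_block mulmx0 addr0 mulmx1.
rewrite (_ : o0 = lshift 3 ord0); last exact: val_inj.
by rewrite !row_mxEl.
Qed.

(** The frame is orthonormal and its spatial members are orthogonal to gamma', so the component
    discarded by [eq_mod_velocity] does not contribute. *)
Let A_gdot k l c s : on_chart c s -> A s k l = gdot (J l) (Es k) c s.
Proof.
move=> hc; have [b] := JE l c s hc.
move/(canRL (subrK _)) => Jb; rewrite /Defs.gdot Jb metric_atD metric_atZ metric_at_sum.
rewrite -(E_vel _ _ hc) -/(gdot (E 0) (Es k) c s) EE // mulr0 add0r.
rewrite (bigD1 k) //= big1 => [|i ik].
  by rewrite -/(gdot (Es k) (Es k) c s) EE // eqxx mulr1 addr0.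
rewrite -/(gdot (Es i) (Es k) c s) EE // (_ : (_ == _) = false) ?mulr0 //.
by apply/negbTE; apply: contra ik => /eqP /(@rshift_inj 1 3) ->.
Qed.

Let dA k l c s : on_chart c s ->
  is_derive s 1 (fun u => A u k l) (gdot (covD (J l)) (Es k) c s).
Proof.
move=> hc; have [_ dJ _ _] := jacJ l.
have e : \near s, gdot (J l) (Es k) c s = A s k l.
  by apply: filterS (near_on_chart hgam _ _ hc) => u hu; rewrite (A_gdot _ _ c).
have := near_eq_is_derive e (is_derive_gdot ha hgam _ _ _ _ dJ (dE _) hc).
move/is_derive_eq; apply.
by rewrite [X in _ + X](_ : _ = 0) ?addr0 // /Defs.gdot DE // /metric_at trmx0 mulmx0 mxE.
Qed.

Let ddA k l c s : on_chart c s ->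
  is_derive s 1 (derive1 (fun u => A u k l)) (- gdot (tidal a gam (J l)) (Es k) c s).
Proof.
move=> hc; have [_ _ dDJ jac] := jacJ l.
have e : \near s, gdot (covD (J l)) (Es k) c s = derive1 (fun u => A u k l) s.
  apply: filterS (near_on_chart hgam _ _ hc) => u hu.
  by rewrite (is_derive1_derive1 _ _ _ (dA k l c u hu)).
have := near_eq_is_derive e (is_derive_gdot ha hgam _ _ _ _ dDJ (dE _) hc).
move/is_derive_eq; apply.
rewrite [X in _ + X](_ : _ = 0) ?addr0; last first.
  by rewrite /Defs.gdot DE // /metric_at trmx0 mulmx0 mxE.
have -> : gdot (covD (covD (J l))) (Es k) c s
    = metric_at (flrw_metric kappa a (cpos gam c s)) (-1 *: tidal a gam (J l) c s) (Es k c s).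
  by congr (metric_at _ _ _); rewrite scaleN1r; apply/eqP; rewrite -addr_eq0; apply/eqP/jac.
by rewrite metric_atZ mulN1r.
Qed.

Let c2 : {c | on_chart c s2}.
Proof. by apply: cid; exact: exists_on_chart. Qed.

(** The conserved values of a E^0, read off at the base point. Up to the factor -1/a they are the
    scalar products of d/dt with the spatial frame vectors. *)
Let p (k : 'I_3) : R := a (T s2) * Es k (projT1 c2) s2 0 o0.

(** A single chart may fail to cover the curve, so a chart is picked at every parameter. By [E_time]
    the resulting function agrees locally with the one of a fixed chart, whose derivative is
    zero. *)
Let p_const k c s : on_chart c s -> a (T s) * Es k c s 0 o0 = p k.
Proof.
move=> hc; have Ds : D s by case: hc.
have hex u : exists d, D u -> on_chart d u.
  have [Du|nDu] := pselect (D u); last by exists c.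
  by have [d hd] := exists_on_chart u Du; exists d.
have [ch hch] := choice hex.
rewrite /Es (E_time (rshift 1 k) (ch s) c s (hch _ Ds) hc).
rewrite /p /Es (E_time (rshift 1 k) (ch s2) _ s2 (hch _ Ds2) (projT2 c2)).
apply: (@derive_eq0_interval R (fun u => a (T u) * E (rshift 1 k) (ch u) u 0 o0) D) => // u Du.
have [d hd] := exists_on_chart u Du.
have e : \near u, a (T u) * E (rshift 1 k) d u 0 o0
    = a (T u) * E (rshift 1 k) (ch u) u 0 o0.
  apply: filterS (near_on_chart hgam _ _ hd) => v hv.
  by rewrite (E_time _ d (ch v) v hv) //; apply: hch; case: hv.
apply: (near_eq_is_derive e); apply: (parallel_time_component ha heps C_gt0 hgam) => //.
- exact: DE.
- by rewrite gdot_vel // EE.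
Qed.

(** Reversing the product in the orthonormality relation gives the completeness relation of the
    frame. Its time-time entry says that the squares of the spatial members' time components sum to
    (u^0)^2 - 1 = C / a^2, where u is the velocity. *)
Let p_norm : \sum_k p k ^+ 2 = C.
Proof.
have [c hc] := c2; have an := scale_factor_neq0 ha _ (T_gt _ Ds2).
have -> : \sum_k p k ^+ 2 = a (T s2) ^+ 2 * \sum_k Es k c s2 0 o0 ^+ 2.
  by rewrite mulr_sumr; apply: eq_bigr => k _; rewrite -(p_const k c s2 hc) exprMn.
pose G := flrw_metric kappa a (cpos gam c s2).
pose Em : 'M[R]_(1 + 3) := \matrix_(i, j) E i c s2 0 j.
pose eta : 'M[R]_(1 + 3) := diag_mx (\row_i (if i == 0 then -1 else 1)).
have rowE i : row i Em = E i c s2 by apply/rowP => j; rewrite !mxE.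
have e1 : Em *m G *m Em^T = eta.
  apply/matrixP => i j; rewrite mul_sandwich_entry !rowE.
  rewrite -/(gdot (E i) (E j) c s2) EE // !mxE.
  by case: eqP; rewrite ?mulr1n ?mulr0n.
have e2 : (Em *m G) *m (Em^T *m eta) = 1%:M.
  rewrite mulmxA e1 mulmx_diag; apply/matrixP => i j; rewrite !mxE.
  by case: (i == 0); rewrite ?mulrNN mulr1.
have := congr1 (fun X : 'M[R]_(1 + 3) => X o0 o0) (mulmx1C e2).
rewrite /G flrw_metric_diag mul_mx_diag [LHS]mxE [RHS]mxE eqxx sum_ord4.
rewrite /eta mul_mx_diag !mxE /= metric_diag_time.
have -> : E o0 c s2 = vel c s2 by rewrite -E_vel //; congr (E _ _ _); exact: val_inj.
have := velocity_time_sqr ha heps C_gt0 hgam _ _ hc; rewrite eps1 => u2.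
rewrite /Es (sum_ord3 (fun i => E i c s2 0 o0 ^+ 2)) => e3.
rewrite (_ : E o1 c s2 0 o0 ^+ 2 + E o2 c s2 0 o0 ^+ 2 + E o3 c s2 0 o0 ^+ 2
  = C / a (T s2) ^+ 2); first by field.
move: e3 u2; rewrite !expr2; lra.
Qed.

(** In matrix form A'' = (q - (hub / a^2) p p^T) A: a scalar operator with a rank-one correction
    along [p], the direction of the plane of d/dt and gamma'. *)
Let ddA_val k l s : D s ->
  is_derive s 1 (derive1 (fun u => A u k l))
    (q (T s) * A s k l
     - hub (T s) / a (T s) ^+ 2 * p k * \sum_j p j * A s j l).
Proof.
move=> Ds; have [c hc] := exists_on_chart s Ds.
have an := scale_factor_neq0 ha _ (T_gt _ Ds).
have := ddA k l c s hc; move/is_derive_eq; apply.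
have [b /(canRL (subrK _)) Jb] := JE l c s hc.
have Evel i : gdot (Es i) vel c s = 0 by rewrite gdot_vel // EE.
have Ju : gdot (J l) vel c s = - b.
  rewrite /Defs.gdot Jb metric_atD metric_atZ metric_at_sum.
  rewrite -/(gdot vel vel c s) (gdot_velocity hgam) // eps1.
  rewrite big1 ?addr0 ?mulrN1 // => i _.
  by rewrite -/(gdot (Es i) vel c s) Evel mulr0.
have Jt : J l c s 0 o0 = b * vel c s 0 o0 + \sum_j A s j l * Es j c s 0 o0.
  rewrite Jb (_ : forall u v : 'rV[R]_(1 + 3), (u + v) 0 o0 = u 0 o0 + v 0 o0).
    rewrite summxE (_ : forall x (v : 'rV[R]_(1 + 3)), (x *: v) 0 o0 = x * v 0 o0).
      by congr (_ + _); apply: eq_bigr => j _; rewrite mxE.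
    by move=> x v; rewrite mxE.
  by move=> u v; rewrite mxE.
have Et j : Es j c s 0 o0 = p j / a (T s) by rewrite -(p_const j c s hc) mulrC mulKf.
pose G := flrw_metric kappa a (cpos gam c s).
pose K := spatial_curvature (kappa := kappa) (a := a) (T s).
(* In the d/dt summand the part of [J] along gamma' cancels, leaving only the frame components of
   [J]; this summand is the source of the rank-one term. *)
have tid : tidal a gam (J l) c s =
    (- K - hub (T s) * (C / a (T s) ^+ 2 + 1)) *: J l c s
    + ((K * b + hub (T s) * (J l c s 0 o0 * vel c s 0 o0)) *: vel c s
    + (- hub (T s) * \sum_j A s j l * Es j c s 0 o0) *: delta_mx 0 o0).
  apply/rowP => i; rewrite (tidalE ha heps C_gt0 hgam) // Ju eps1.
  have addE (u v : 'rV[R]_(1 + 3)) m : (u + v) 0 m = u 0 m + v 0 m by rewrite mxE.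
  have scaleE (r : R) (v : 'rV[R]_(1 + 3)) m : (r *: v) 0 m = r * v 0 m by rewrite mxE.
  rewrite !addE !scaleE [delta_mx _ _ _ _]mxE eqxx /= -/K.
  move: (J l c s 0 i) => Ji; rewrite Jt; ring.
have e0 : metric_at G (delta_mx 0 o0) (Es k c s) = - Es k c s 0 o0.
  rewrite flrw_metric_at sum_ord4 metric_diag_time !mxE /=; ring.
have vE : metric_at G (vel c s) (Es k c s) = 0.
  by rewrite -(E_vel _ _ hc) -/(gdot (E 0) (Es k) c s) EE.
have -> : gdot (tidal a gam (J l)) (Es k) c s =
    (- K - hub (T s) * (C / a (T s) ^+ 2 + 1)) * A s k l
    + hub (T s) * (\sum_j A s j l * Es j c s 0 o0) * Es k c s 0 o0.
  rewrite (A_gdot k l c s hc) /Defs.gdot tid !metric_atD !metric_atZ e0 vE; ring.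
have -> : \sum_j A s j l * Es j c s 0 o0 = (\sum_j p j * A s j l) / a (T s).
  by rewrite mulr_suml; apply: eq_bigr => j _; rewrite Et; ring.
rewrite Et /transverse_coef eps1 /K /spatial_curvature /hubble_term.
by move: (\sum_j _) => S; field.
Qed.

(** The row y = p^T A solves the radial equation since |p|^2 = C, and the projection B = A - p y / C
    solves the transverse one. Thus A is a rank-one matrix with bounded factor [y] plus a matrix
    tending to 0, and its determinant tends to 0. *)
Lemma timelike_jacobi_det_cvg0 : \det (A (tau t)) @[t --> t0^'+] --> 0.
Proof.
pose A1 k l s := derive1 (fun u => A u k l) s.
have dA1 k l s : D s -> is_derive s 1 (fun u => A u k l) (A1 k l s).
  move=> Ds; have [c hc] := exists_on_chart s Ds.
  by apply: derivable_is_derive1; exact: is_derive1_derivable (dA k l c s hc).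
have A0 k l : A s2 k l = 0.
  have [c hc] := exists_on_chart s2 Ds2.
  rewrite (A_gdot k l c s2 hc) /Defs.gdot; have [-> _] := J0 l c hc.
  by rewrite /metric_at !mul0mx mxE.
pose y l s := \sum_k p k * A s k l.
pose y1 l s := \sum_k p k * A1 k l s.
have dy l s : D s -> is_derive s 1 (y l) (y1 l s).
  by move=> Ds; apply: is_derive1_sum => k; apply: is_derive1Z; exact: dA1.
have dy1 l s : D s ->
    is_derive s 1 (y1 l) (derive1n 2 a (T s) / a (T s) * y l s).
  move=> Ds; have an := scale_factor_neq0 ha _ (T_gt _ Ds).
  have := is_derive1_sum _ _ _ _ (fun k => is_derive1Z _ (p k) _ _ (ddA_val k l s Ds)).
  move/is_derive_eq; apply; rewrite -/(y l s).
  transitivity (\sum_k (q (T s) * (p k * A s k l)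
      - hub (T s) / a (T s) ^+ 2 * y l s * p k ^+ 2)).
    by apply: eq_bigr => k _; ring.
  rewrite sumrB -!mulr_sumr p_norm -/(y l s) /transverse_coef eps1; ring.
have y0 l : y l s2 = 0 by rewrite /y big1 // => k _; rewrite A0 mulr0.
pose B k l s := A s k l - p k / C * y l s.
have Cn : C != 0 by rewrite gt_eqF.
have B0 k l : B k l (tau t) @[t --> t0^'+] --> 0.
  apply: (transverse_cvg0 (B k l) (fun s => A1 k l s - p k / C * y1 l s)).
  - by move=> s Ds; apply: is_derive1B; [exact: dA1|apply: is_derive1Z; exact: dy].
  - move=> s Ds; have an := scale_factor_neq0 ha _ (T_gt _ Ds).
    have := is_derive1B _ _ _ _ _ (ddA_val k l s Ds)
      (is_derive1Z _ (p k / C) _ _ (dy1 l s Ds)).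
    move/is_derive_eq; apply; rewrite -/(y l s) /B /transverse_coef eps1.
    by field; rewrite an Cn.
  - by rewrite /B A0 y0 mulr0 subr0.
apply: (det3_rank1_cvg0 (fun t => A (tau t)) (fun k => p k / C)
  (fun l t => y l (tau t)) (fun k l t => B k l (tau t))) => //.
  by move=> t k l; rewrite /B addrC subrK.
move=> l.
exact: (radial_jacobi_bounded ha heps C_gt0 iD Ds2 T_gt T_onto htau
  (is_derive_time ha heps C_gt0 hgam) (y l) (y1 l) eps1 (dy l) (dy1 l) (y0 l)).
Qed.

End timelike.
End focusing.

(** * Conjugacy to the singularity *)

Theorem mainTheorem1 (R : realType) (kappa t0 : R) (a : R -> R)
    (ha : scale_factor t0 a)
    (M : space_form kappa) (gam : curve R M) (tau : R -> R) (eps C t1 : R)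
    (heps : eps = -1 \/ eps = 0) (hC : 0 < C)
    (hgam : is_geodesic a gam t0 eps C)
    (htau : forall s, cdom gam s -> tau (ctime gam s) = s)
    (ht1 : t0 < t1)
    (hint : (\int[lebesgue_measure]_(t' in `[t, t1])
               (a t' * \int[lebesgue_measure]_(t'' in `[t', t1])
                         ((a t'')^-1 * hubble_term kappa a t''))
            ) @[t --> t0^'+] --> -oo)
    (hf : exists2 alpha : R, 0 <= alpha &
            (\int[lebesgue_measure]_(t' in `[t, t1])
               (focusing kappa C a)^\+ t') @[t --> t0^'+] --> alpha)
    (t2 : R) (ht2 : (ctime gam @` cdom gam) t2) :
  (eps = -1 -> forall A : R -> 'M[R]_3,
     timelike_jacobi_tensor a gam (tau t2) A ->
     exists2 t' : R, t0 <= t' < t2 & conjugate_at A tau t0 t') /\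
  (eps = 0 -> forall A : R -> 'M[R]_2,
     null_jacobi_tensor a gam (tau t2) A ->
     exists2 t' : R, t0 <= t' < t2 & conjugate_at A tau t0 t').
Proof.
case: ht2 => s2 Ds2 <-; rewrite htau //.
have tt2 : t0 < ctime gam s2 by have [[_ h _ _] _] := hgam; exact: h.
split=> [eps1 A [E [J [hE jacJ J0 JE]]]|eps0 A hA];
  (* In both cases the conjugate point is the singularity, and the limit form of [conjugate_at] is
     proved. *)
  exists t0; rewrite ?lexx ?tt2 //; right; split => //.
- exact: (timelike_jacobi_det_cvg0 ha heps hC hgam htau ht1 hint Ds2 eps1 A E J).
- apply: det2_cvg0.
  exact: (null_jacobi_entry_cvg0 ha heps hC hgam htau ht1 hint Ds2 A).
Qed.
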